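(* Let $C$ be a plane reduced curve and $P\in C$ a double point of $C$. Let $D$ be a plane curve, smooth at $P$. Then: (i) Assume $P$ is an $A_{2r-1}$ or an $A_{2r}$ singularity. If $i(C,D,P) \leq 2r$, then it is an even number. (ii) If $P$ is an $A_{2r-1}$ singularity for $C$, there are curves $D_1$ and $D_2$ smooth at $P$ such that $i(C,D_j,P)\geq 2r+1$ for $j=1,2$ and $i(D_1,D_2,P)=r$. (iii) If $P$ is an $A_{2r}$ singularity for $C$, then $i(C,D,P)\leq 2r+1$, and there exist curves smooth at $P$ which attain the equality. If $D_1, D_2$ are curves such that $i(C,D_j,P)= 2r+1$ for $j=1,2$, then $i(D_1,D_2,P)>r$. (iv) Let $O$ be an $A_{s}$ singularity for $C$, with $s=2r-1$ or $s=2r$, $s\geq 2$, and suppose that the tangent of $C$ at $O$ is not the $y$-axis. Then any curve $D$, smooth at $O$ and such that $i(C,D,O)\geq 2r+1$, has a local analytic equation of the form $$y=\sum_{i= 2}^{r-1} c_ix^i +c_rx^r+\sum_{i\geq r+1} c_ix^i$$ where $\sum_{i\geq r+1} c_ix^i$ is convergent, and $c_2,\dots,c_{r}$ are fixed if $s=2r$, while $c_2,\dots,c_{r-1}$ are fixed and there are only two (different) possibilities for $c_r$ if $s=2r-1$.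
   Context: The ground field is $\mathbb{C}$. A singularity of type $A_s$ of a plane curve is a double point which, writing $s=2m-\varepsilon$ with $m$ a positive integer and $\varepsilon\in\{0,1\}$, can be resolved via $m$ blow-ups and whose desingularization yields two points if $\varepsilon=1$ and only one if $\varepsilon=0$; at such a point the curve is analytically isomorphic to $y^2-x^{s+1}=0$ at the origin. The letter $r$ denotes a positive integer. $i(C,D,P)$ denotes the intersection multiplicity of the curves $C$ and $D$ at the point $P$. In (iv), $O=(0,0)$ is the origin of an affine chart of the plane with coordinates $x,y$.
   Formalization: In (iv) the local equation of D may also contain a linear term c_1 x, with c_1 fixed as the slope of the tangent of C at O (so c_1=0 when that tangent is the x-axis); without it the claim fails, e.g. for C: (y-x)^2=x^4 and D: y=x+x^2. *)

(* Defs.v *)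
From HB Require Import structures.
From mathcomp Require Import all_boot all_order all_algebra.
From mathcomp Require Import complex.
From mathcomp Require Import all_classical all_reals all_analysis.
Set Implicit Arguments.
Unset Strict Implicit.
Unset Printing Implicit Defensive.
Import Order.TTheory GRing.Theory Num.Theory.
Import numFieldNormedType.Exports.

Local Open Scope ring_scope.

(* Conventions of polyXY: for f : {poly {poly K}} the outer variable 'X is the
   coordinate x, the inner one 'Y (that is 'X%:P) is the coordinate y,
   f.[a, b] is the value at x = a, y = b, and f`_i`_j is the coefficient of
   x^i y^j.  A plane curve is given by a nonconstant polynomial equation.
   Everything below is local at a point of an affine chart. *)

Definition plane_curve (K : fieldType) (f : {poly {poly K}}) : Prop :=
  f != 0 /\ f \isn't a GRing.unit.

Definition reduced_curve (K : fieldType) (f : {poly {poly K}}) : Prop :=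
  forall g h : {poly {poly K}}, f = g ^+ 2 * h -> g \is a GRing.unit.

(* f(u, v) *)
Definition subst2 (K : fieldType) (u v f : {poly {poly K}}) : {poly {poly K}} :=
  (map_poly (map_poly (@polyC {poly K} \o @polyC K)) f).[u, v].

(* the equation f in coordinates centered at P *)
Definition centered (K : fieldType) (f : {poly {poly K}}) (P : K * K) :
    {poly {poly K}} :=
  subst2 ('X + P.1%:P%:P) ('Y + P.2%:P%:P) f.

Definition has_mult (K : fieldType) (n : nat) (f : {poly {poly K}}) : Prop :=
  (forall i j : nat, (i + j < n)%N -> f`_i`_j = 0) /\
  (exists i j : nat, (i + j = n)%N /\ f`_i`_j != 0).

Definition smooth_at (K : fieldType) (f : {poly {poly K}}) (P : K * K) : Prop :=
  has_mult 1 (centered f P).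

Definition double_point (K : fieldType) (f : {poly {poly K}}) (P : K * K) :
    Prop :=
  has_mult 2 (centered f P).

(* The line through the origin with direction (u, v) is tangent to f = 0 at
   the origin: (u, v) is a zero of the leading form. *)
Definition tangent_direction (K : fieldType) (f : {poly {poly K}}) (u v : K) :
    Prop :=
  (u, v) != (0, 0) /\
  exists n : nat, has_mult n f /\
    \sum_(i < n.+1) f`_i`_(n - i) * u ^+ i * v ^+ (n - i) = 0.

(* The points of the exceptional divisor of the blow-up of the origin:
   Some t is the line y = t x, and None is the line x = 0.  The chart at
   such a point has this point as its origin. *)
Definition blowup_pullback (K : fieldType) (d : option K)
    (f : {poly {poly K}}) : {poly {poly K}} :=
  if d is Some t then subst2 'X ('X * ('Y + t%:P%:P)) f
  else subst2 ('X * 'Y) 'Y f.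

Definition exceptional (K : fieldType) (d : option K) : {poly {poly K}} :=
  if d is Some _ then 'X else 'Y.

Definition strict_transform (K : fieldType) (f : {poly {poly K}})
    (d : option K) (g : {poly {poly K}}) : Prop :=
  exists n : nat, has_mult n f /\ blowup_pullback d f = exceptional d ^+ n * g.

Definition infinitely_near (K : fieldType) (f : {poly {poly K}})
    (d : option K) : Prop :=
  exists g : {poly {poly K}}, strict_transform f d g /\ g.[0, 0] = 0.

(* resolved m k f: the germ f = 0 at the origin is desingularized by exactly m
   blow-ups, each centered at a singular point of the current strict transform,
   and k points of the desingularization lie over the origin. *)
Inductive resolved (K : fieldType) : nat -> nat -> {poly {poly K}} -> Prop :=
| resolved_smooth (f : {poly {poly K}}) : has_mult 1 f -> resolved 0 1 f
| resolved_blowup (f : {poly {poly K}}) (n : nat) (s : seq (option K))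
    (g : option K -> {poly {poly K}}) (m k : option K -> nat) :
    has_mult n f -> (1 < n)%N -> uniq s ->
    (forall d, d \in s <-> infinitely_near f d) ->
    (forall d, d \in s -> strict_transform f d (g d)) ->
    (forall d, d \in s -> resolved (m d) (k d) (g d)) ->
    resolved (\sum_(d <- s) m d).+1 (\sum_(d <- s) k d) f.

Definition A_singularity (K : fieldType) (s : nat) (f : {poly {poly K}})
    (P : K * K) : Prop :=
  double_point f P /\
  exists (m : nat) (e : bool), [/\ (0 < m)%N, s = (2 * m - e)%N &
    resolved m (if e then 2 else 1) (centered f P)].

(* the local ring of the plane at P *)
Definition regular_at (K : fieldType) (P : K * K)
    (q : {fraction {poly {poly K}}}) : Prop :=
  exists a b : {poly {poly K}}, b.[P.1, P.2] != 0 /\ q = tofrac a / tofrac b.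

(* the ideal of the local ring generated by f and g *)
Definition local_ideal (K : fieldType) (f g : {poly {poly K}}) (P : K * K)
    (q : {fraction {poly {poly K}}}) : Prop :=
  exists u v, [/\ regular_at P u, regular_at P v &
    q = u * tofrac f + v * tofrac g].

Definition free_mod_local_ideal (K : fieldType) (f g : {poly {poly K}})
    (P : K * K) (n : nat) (h : 'I_n -> {fraction {poly {poly K}}}) : Prop :=
  forall c : 'I_n -> K,
    local_ideal f g P (\sum_i tofrac (c i)%:P%:P * h i) ->
    forall i, c i = 0.

(* i(f, g, P), the dimension over the ground field of the quotient of the local
   ring at P by (f, g); it is +oo when f and g share a component through P. *)
Definition imult (R : realType) (f g : {poly {poly R[i]}})
    (P : R[i] * R[i]) : \bar R :=
  ereal_sup [set (n%:R)%:E | n in [set n : nat |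
    exists h : 'I_n -> {fraction {poly {poly R[i]}}},
      (forall i, regular_at P (h i)) /\ free_mod_local_ideal f g P h]].

Definition pseries (K : numFieldType) (c : nat -> K) (x : K) : nat -> K :=
  series (fun i : nat => c i * x ^+ i).

(* Near the origin the curve f = 0 is the graph of the convergent power series
   y = \sum_i c_i x^i. *)
Definition local_analytic_equation (K : numFieldType) (f : {poly {poly K}})
    (c : nat -> K) : Prop :=
  exists e : K, 0 < e /\
    forall x : K, `|x| < e ->
      cvgn (pseries c x) /\
      forall y : K, `|y| < e ->
        (f.[x, y] = 0 <-> y = limn (pseries c x)).

(* Main.v *)
Require Import Defs.
From HB Require Import structures.
From mathcomp Require Import all_boot all_order all_algebra.
From mathcomp Require Import complex.
From mathcomp Require Import all_classical all_reals all_analysis.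
From mathcomp Require Import ring zify.
Set Implicit Arguments.
Unset Strict Implicit.
Unset Printing Implicit Defensive.
Import Order.TTheory GRing.Theory Num.Theory.
Import numFieldNormedType.Exports.
Local Open Scope ring_scope.

(** A double point of type A_(2r-1) or A_(2r) has a normal form from which every
    contact number can be read. In suitable coordinates, view the equation f as a
    polynomial in y over K[x]. Blowing up r times along the infinitely near double points amounts to
    the substitution y = p(x) + x^r Y, where the coefficients of the polynomial p
    are the slopes of the successive tangents. So f expands along the smooth
    curve y = p(x) as
      f = x^(2r) a(x) + x^r b(x) (y - p) + g(x, y) (y - p)^2,  g(0, 0) <> 0,
    and the end of the resolution distinguishes the two types by the polynomial
      q(t) = a(0) + b(0) t + g(0, 0) t^2:
    it has two distinct roots for A_(2r-1), while for A_(2r) it reduces to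
    g(0, 0) t^2 and a has a simple zero. This is [A_form]; it is derived from the
    resolution in [resolved_A_form].

    A smooth curve which is not vertical is a graph y = d(x), and its intersection
    number with f is the order of f(x, d(x)) ([codim_ge_graph], [codim_lt_graph]).
    Write d = p + e. If e has order k < r, the term g (y - p)^2 dominates and the
    order is 2k. If e = t x^r + higher terms, the coefficient of x^(2r) is q(t), and
    the order is 2r unless t is a root of q. This dichotomy ([contact_dichotomy])
    shows that contact up to 2r is even, that higher contact determines the
    coefficients of d up to order r - 1 and leaves the roots of q for the next
    one, and that contact with A_(2r) is at most 2r + 1. A vertical smooth curve
    meets f with multiplicity 2. Conversely the curves y = p + t x^r, with t a
    root of q, have the required contact.

    A curve D meeting an A_(2r) point with multiplicity 2r + 1 is automatically
    smooth ([cusp_odd_smooth]). Modulo f and up to a unit, a germ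
    al x^k + be (y - p) with be(0, 0) = 0 is x times a germ of the same shape with
    k - 1 in place of k, and the factor x contributes exactly i(f, x) = 2 to the
    intersection number. Peeling off these factors shows that a singular D has an
    even intersection number below 2r + 1 or one that is at least 2r + 2.

    The convergence of the graph of a smooth curve c comes from the iteration
    y <- y - c(x, y) / c_y(0, 0). It is a contraction for the norm
    sum |y_i| e^i on polynomials when e is small, and its n-th iterate is exact
    up to order n, so that the same iterates compute the coefficients of the
    series ([analytic_graph]). *)

(** * Orders of vanishing and Taylor expansions *)

Section Univariate.
Variable K : fieldType.
Implicit Types (p q e : {poly K}) (n k : nat).

Lemma horner0E p : p.[0] = p`_0.
Proof. by rewrite horner_coef0. Qed.

Lemma dvdXnP n p : reflect (forall i, (i < n)%N -> p`_i = 0) ('X^n %| p).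
Proof.
apply: (iffP idP) => [/dvdpP[q ->] i lt_in|p0]; first by rewrite coefMXn lt_in.
suff -> : p = drop_poly n p * 'X^n by rewrite dvdp_mulIr.
rewrite -{1}(poly_take_drop n p) [take_poly n p](_ : _ = 0) ?add0r//.
by apply/polyP => i; rewrite coef_take_poly coef0; case: ifP => // /p0.
Qed.

Lemma dvdXnE n p : reflect (exists e, p = 'X^n * e) ('X^n %| p).
Proof.
apply: (iffP idP) => [/dvdpP[q ->]|[e ->]]; first by exists q; rewrite mulrC.
by rewrite dvdp_mulr.
Qed.

Lemma root0_factor p : p.[0] = 0 -> exists e, p = 'X * e.
Proof.
rewrite horner0E => p0; have /dvdXnE[e ->] : 'X^1 %| p.
  by apply/dvdXnP => -[].
by exists e; rewrite expr1.
Qed.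

Lemma coef_XnM_low n e i : (i < n)%N -> ('X^n * e)`_i = 0.
Proof. by rewrite coefXnM => ->. Qed.

Lemma coef_XnM_lead n e : ('X^n * e)`_n = e.[0].
Proof. by rewrite coefXnM ltnn subnn horner0E. Qed.

Lemma Xn_neq0 n : 'X^n != 0 :> {poly K}.
Proof. by rewrite expf_neq0 ?polyX_eq0. Qed.

(** The two cases of every order computation below: a power of X of the wanted
    order can be factored out, or the first nonzero coefficient comes earlier. *)
Lemma Xn_split n p : 'X^n %| p \/
  exists k e, [/\ (k < n)%N, p = 'X^k * e & e.[0] != 0].
Proof.
elim: n => [|n [/dvdXnE[e ->]|[k [e [lt_kn pE e0]]]]]; first by left; rewrite dvd1p.
  have [e0|e0] := eqVneq e.[0] 0; last by right; exists n, e.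
  left; have [e' ->] := root0_factor e0.
  by rewrite mulrA -exprSr dvdp_mulr.
by right; exists k, e; rewrite ltnS ltnW.
Qed.

Lemma dvdXn_unitl n u p : u.[0] != 0 -> 'X^n %| u * p -> 'X^n %| p.
Proof.
move=> u0 dvd_up; have [//|[k [e [lt_kn pE e0]]]] := Xn_split n p.
move/dvdXnP: dvd_up => /(_ k lt_kn) /eqP.
by rewrite pE mulrCA coef_XnM_lead hornerM mulf_eq0 (negPf u0) (negPf e0).
Qed.

End Univariate.

Section Bivariate.
Variable K : fieldType.
Implicit Types (f g h : {poly {poly K}}) (p q : {poly K}) (n : nat).

(** In {poly {poly K}} the outer variable is read as y and the inner one as x, so
    that f.[p] is f(x, p(x)). *)
Lemma horner_horner f p a : f.[p].[a] = f.[p.[a], a].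
Proof.
elim/poly_ind: f => [|f c IHf]; first by rewrite !horner0.
by rewrite !hornerE IHf.
Qed.

Lemma horner_at0 f p : p.[0] = 0 -> f.[p].[0] = f.[0, 0].
Proof. by rewrite horner_horner => ->. Qed.

Lemma horner00 f : f.[0, 0] = f`_0`_0.
Proof. by rewrite polyC0 !horner_coef0. Qed.

Lemma poly_factor f p : exists g, f = f.[p]%:P + g * ('X - p%:P).
Proof.
have /factor_theorem[g gE] : root (f - f.[p]%:P) p.
  by rewrite /root hornerD hornerN hornerC subrr.
by exists g; rewrite -gE addrC subrK.
Qed.

Lemma poly_taylor2 f p :
  exists g, f = f.[p]%:P + f^`().[p]%:P * ('X - p%:P) + g * ('X - p%:P) ^+ 2.
Proof.
have [g fE] := poly_factor f p; have [h gE] := poly_factor g p.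
exists h; have -> : f^`().[p] = g.[p].
  by rewrite fE !poly.derivE !hornerE; ring.
by rewrite {1}fE {1}gE; ring.
Qed.

Lemma horner_taylor2 f p q :
  exists e, f.[p + q] = f.[p] + f^`().[p] * q + q ^+ 2 * e.
Proof.
have [g fE] := poly_taylor2 f p; exists g.[p + q].
by rewrite {1}fE !(horner_exp, hornerM, hornerD, hornerN, hornerC, hornerX); ring.
Qed.

Lemma horner_sub_dvd f p q : exists e, f.[q] - f.[p] = (q - p) * e.
Proof.
have [g fE] := poly_factor f p; exists g.[q].
by rewrite {1}fE !(hornerM, hornerD, hornerN, hornerC, hornerX); ring.
Qed.

End Bivariate.

(** * Dimension modulo an ideal of the local ring at the origin *)

Section LocalCodim.
Variable K : fieldType.
Implicit Types (f g h b u v w : {poly {poly K}}) (p e : {poly K}) (n k : nat).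

(** The ideal of the local ring generated by f and g, restricted to polynomials:
    b is the common denominator of the coefficients. *)
Definition local_mem f g h :=
  exists b u v, b.[0, 0] != 0 /\ b * h = u * f + v * g.

(** A lower bound on the dimension of the quotient of the local ring by (f, g).
    Bounds, rather than the dimension, are what survives when f and g share a
    component. Polynomials suffice, because a common denominator is a unit of
    the local ring. *)
Definition codim_ge f g n :=
  exists h : 'I_n -> {poly {poly K}}, forall c : 'I_n -> K,
    local_mem f g (\sum_i (c i)%:P%:P * h i) -> forall i, c i = 0.

Lemma horner00M f g : (f * g).[0, 0] = f.[0, 0] * g.[0, 0].
Proof. by rewrite !hornerM. Qed.

Lemma horner00D f g : (f + g).[0, 0] = f.[0, 0] + g.[0, 0].
Proof. by rewrite !hornerD. Qed.

Lemma codim_ge0 f g : codim_ge f g 0.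
Proof. by exists (fun=> 0) => c _ []. Qed.

Lemma codim_geS f g n : codim_ge f g n.+1 -> codim_ge f g n.
Proof.
case=> h free_h; exists (fun i => h (widen_ord (leqnSn n) i)) => c mem_c i.
pose c' (j : 'I_n.+1) := oapp c 0 (insub (val j)).
have c'E j : c' (widen_ord (leqnSn n) j) = c j.
  by rewrite /c' (_ : insub _ = Some j) //; exact: valK.
rewrite -c'E; apply: free_h; rewrite big_ord_recr /= {2}/c' insubF ?ltnn //=.
rewrite !polyC0 mul0r addr0.
by under eq_bigr do rewrite c'E.
Qed.

Lemma codim_ge_le f g m n : (m <= n)%N -> codim_ge f g n -> codim_ge f g m.
Proof.
move=> /subnK <-; elim: (n - m)%N => // k IHk.
by rewrite addSn => /codim_geS.
Qed.

Lemma codim_ge_sub f g f' g' n :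
    (forall h, local_mem f g h -> local_mem f' g' h) ->
  codim_ge f' g' n -> codim_ge f g n.
Proof.
by move=> sub [h free_h]; exists h => c mem_c; apply: free_h; exact: sub.
Qed.

(** The generator g may be replaced by anything that agrees with it modulo f up to
    a unit u. *)
Lemma local_mem_equiv f g g' w w' u h :
    u.[0, 0] != 0 -> u * g' = w * f + w' * g ->
  local_mem f g' h -> local_mem f g h.
Proof.
move=> u0 ug' [b [s [t [b0 bh]]]].
exists (u * b), (u * s + t * w), (t * w').
split; first by rewrite horner00M mulf_neq0.
by rewrite -mulrA bh mulrDr mulrCA [u * (t * _)]mulrCA ug'; ring.
Qed.

Lemma codim_ge_unit f g n : g.[0, 0] != 0 -> codim_ge f g n -> n = 0%N.
Proof.
case: n => // n g0 [h free_h].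
have mem1 : local_mem f g (\sum_i ((i == ord0)%:R)%:P%:P * h i).
  by exists g, 0, (\sum_i ((i == ord0)%:R)%:P%:P * h i); rewrite mul0r add0r mulrC.
by have /eqP := free_h (fun i => (i == ord0)%:R) mem1 ord0; rewrite eqxx oner_eq0.
Qed.

End LocalCodim.

(** * Intersection with a smooth curve *)

Section SmoothCurve.
Variable K : fieldType.
Implicit Types (f g h : {poly {poly K}}) (p q e : {poly K}) (n k : nat).

(** The iteration y <- y - g(x, y) / g_y(0, 0), starting at y = 0. It gains one
    order at each step, and no division by a series is needed, so the iterates
    stay polynomial. *)
Fixpoint picard g n : {poly K} :=
  if n is n'.+1 then picard g n' - (g^`().[0, 0])^-1%:P * g.[picard g n'] else 0.

(** If x^(n+1) divides g(x, y_n), the first-order Taylor expansion multiplies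
    g(x, y_n) by 1 - g_y(x, y_n) / g_y(0, 0), which vanishes at the origin, up to
    a term of order 2n + 2. *)
Lemma picard_graph g n : g.[0, 0] = 0 -> g^`().[0, 0] != 0 ->
  (picard g n).[0] = 0 /\ 'X^(n.+1) %| g.[picard g n].
Proof.
move=> g0 g'0; elim: n => [|n [p0]] /=.
  rewrite horner0; split=> //; have [e ->] := root0_factor g0.
  by rewrite dvdp_mulr.
set p := picard g n in p0 *; set c := (_^-1) => /dvdXnE[e gp].
have gp0 : g.[p].[0] = 0 by rewrite horner_at0.
split; first by rewrite !(hornerD, hornerN, hornerM) p0 gp0 mulr0 subrr.
have [e' ->] := horner_taylor2 g p (- (c%:P * g.[p])).
have [d dE] : exists d, 1 - c%:P * g^`().[p] = 'X * d.
  apply: root0_factor; rewrite !(hornerD, hornerN, hornerM) !hornerC.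
  by rewrite horner_at0 // mulVf // subrr.
rewrite [X in _ %| X](_ : _ = g.[p] * ((1 - c%:P * g^`().[p]) +
  c%:P ^+ 2 * g.[p] * e')); last by ring.
rewrite dE gp [X in _ %| X](_ : _ = 'X^(n.+2) *
  (e * (d + c%:P ^+ 2 * 'X^n * e * e'))); first by rewrite dvdp_mulr.
by rewrite !exprS; ring.
Qed.

(** Restriction to the curve y = p(x) kills the ideal (f, g) modulo x^n, while the
    powers 1, x, ..., x^(n-1) stay independent. *)
Lemma codim_ge_graph f g p n : p.[0] = 0 ->
  'X^n %| f.[p] -> 'X^n %| g.[p] -> codim_ge f g n.
Proof.
move=> p0 fp gp; exists (fun i => ('X^i)%:P) => c [b [u [v [b0 bE]]]].
suff /dvdXnP c0 : 'X^n %| \sum_(i < n) (c i)%:P * 'X^i.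
  move=> i; rewrite -[RHS](c0 i (ltn_ord i)) coef_sum (bigD1 i) //= coefCM.
  rewrite coefXn eqxx mulr1 big1 ?addr0 // => j ji.
  by rewrite coefCM coefXn eq_sym (inj_eq val_inj) (negPf ji) mulr0.
apply: (@dvdXn_unitl _ _ b.[p]); first by rewrite horner_at0.
have -> : \sum_(i < n) (c i)%:P * 'X^i =
    (\sum_(i < n) (c i)%:P%:P * ('X^i)%:P).[p].
  by rewrite horner_sum; apply: eq_bigr => i _; rewrite hornerM !hornerC.
by rewrite -hornerM bE hornerD !hornerM dvdp_add // dvdp_mull.
Qed.

(** On the curve g = 0 the function y - p is divisible by x^(n+1), because
    g = g(x, p) + v (y - p) with v a unit. Hence f is x^n times a unit modulo g, so
    that x^n lies in (f, g), and so does h, which is h(x, p) plus a multiple of y - p. *)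
Lemma graph_local_mem f g h p n e : g^`().[0, 0] != 0 -> p.[0] = 0 ->
    'X^(n.+1) %| g.[p] -> f.[p] = 'X^n * e -> e.[0] != 0 -> 'X^n %| h.[p] ->
  local_mem f g h.
Proof.
move=> g'0 p0 /dvdXnE[d gp] fp e0 /dvdXnE[s hp].
have [v gE] := poly_factor g p; have [z fE] := poly_factor f p.
have [w hE] := poly_factor h p.
have v0 : v.[0, 0] != 0.
  rewrite -(horner_at0 v p0) [v.[p]](_ : _ = g^`().[p]) ?horner_at0 //.
  by rewrite gE !poly.derivE !(hornerM, hornerD, hornerN, hornerC, hornerX); ring.
rewrite fp in fE; rewrite gp in gE; rewrite hp in hE.
pose b1 := v * e%:P - z * ('X * d)%:P.
exists (b1 * v), (v * (v * s%:P - w * ('X * d)%:P)),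
  (b1 * w - z * (v * s%:P - w * ('X * d)%:P)).
have b1_0 : b1.[0, 0] != 0.
  rewrite /b1 !(hornerD, hornerN, hornerM) !hornerC.
  by rewrite !hornerM hornerX mul0r mulr0 subr0 mulf_neq0.
split; first by rewrite horner00M mulf_neq0.
by rewrite hE fE gE /b1 !exprS !polyCM; ring.
Qed.

(** Restricting to the curve modulo x^n maps n + 1 polynomials into a space of
    dimension n, and a linear relation between the images is one modulo (f, g) by
    [graph_local_mem]. *)
Lemma codim_lt_graph f g p n e : g^`().[0, 0] != 0 -> p.[0] = 0 ->
    'X^(n.+1) %| g.[p] -> f.[p] = 'X^n * e -> e.[0] != 0 ->
  ~ codim_ge f g n.+1.
Proof.
move=> g'0 p0 gp fp e0 [h free_h].
pose M : 'M[K]_(n.+1, n) := \matrix_(i, j) (h i).[p]`_j.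
have [c c_neq0 cM] : exists2 c : 'rV_(n.+1), c != 0 & c *m M = 0.
  have /rowV0Pn[c /sub_kermxP cM c0] : kermx M != 0.
    by rewrite kermx_eq0 /row_free neq_ltn ltnS rank_leq_col.
  by exists c.
case/negP: c_neq0; apply/eqP/rowP => i; rewrite mxE.
apply: (free_h (fun j => c ord0 j)).
apply: (graph_local_mem g'0 p0 gp fp e0); apply/dvdXnP => j lt_jn.
have /rowP/(_ (Ordinal lt_jn)) := cM; rewrite !mxE => cMj; rewrite -[RHS]cMj.
rewrite horner_sum coef_sum; apply: eq_bigr => k _.
by rewrite hornerM hornerC coefCM mxE.
Qed.

(** A smooth curve with vertical tangent is a graph x = q(y), where q has no linear
    term since g(q(y), y) has none. *)
Lemma vertical_graph g n : g.[0, 0] = 0 -> g^`().[0, 0] = 0 -> g`_0`_1 != 0 ->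
  exists q, [/\ q.[0] = 0, 'X^2 %| q & 'X^n %| (swapXY g).[q]].
Proof.
move=> g0 g'0 g01.
have sg0 : (swapXY g).[0, 0] = 0 by rewrite horner2_swapXY.
have sg'0 : (swapXY g)^`().[0, 0] != 0.
  by rewrite horner00 coef_deriv coef_swapXY.
have [] := picard_graph n.+1 sg0 sg'0; set q := picard _ _ => q0 gq.
exists q; split=> //; last by apply: dvdp_trans gq; rewrite dvdp_exp2l // ltnW.
have [q1 qE] := root0_factor q0.
suff q10 : q1.[0] = 0.
  have [q2 q1E] := root0_factor q10.
  by rewrite qE q1E mulrA -expr2 dvdp_mulr.
have [e gqE] := horner_taylor2 (swapXY g) 0 q; rewrite add0r in gqE.
have := dvdXnP _ _ gq 1%N isT; rewrite gqE.
rewrite qE mulrCA exprMn -mulrA !coefD.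
rewrite [X in X + _ + _](_ : _ = 0); last first.
  rewrite horner_coef0 coef_swapXY.
  by move: g'0; rewrite horner00 coef_deriv mulr1n.
rewrite add0r coefXM /= coef_XnM_low // addr0 -horner0E hornerM => /eqP.
by rewrite mulf_eq0 -polyC0 (negPf sg'0) => /eqP.
Qed.

End SmoothCurve.

(** * Exchanging the two variables *)

Section SwapEval.
Variable K : fieldType.
Implicit Types (f g h : {poly {poly K}}) (p q a b e : {poly K}) (n k r : nat).

(** f(q(y), y), as a polynomial in y. *)
Definition eval_inner q f : {poly K} := (swapXY f).[q].

Lemma eval_innerD q f g : eval_inner q (f + g) = eval_inner q f + eval_inner q g.
Proof. by rewrite /eval_inner rmorphD hornerD. Qed.

Lemma eval_innerN q f : eval_inner q (- f) = - eval_inner q f.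
Proof.
by rewrite /eval_inner -[- f]sub0r swapXY_is_zmod_morphism rmorph0 sub0r hornerN.
Qed.

Lemma eval_innerM q f g : eval_inner q (f * g) = eval_inner q f * eval_inner q g.
Proof. by rewrite /eval_inner rmorphM hornerM. Qed.

Lemma eval_innerXn q f n : eval_inner q (f ^+ n) = eval_inner q f ^+ n.
Proof. by rewrite /eval_inner rmorphXn horner_exp. Qed.

Lemma eval_innerC q a : eval_inner q a%:P = a \Po q.
Proof. by rewrite /eval_inner swapXY_polyC. Qed.

Lemma eval_innerX q : eval_inner q 'X = 'X.
Proof. by rewrite /eval_inner swapXY_X hornerC. Qed.

Lemma eval_inner_at0 q f : q.[0] = 0 -> (eval_inner q f).[0] = f.[0, 0].
Proof. by move=> q0; rewrite /eval_inner (horner_at0 _ q0) horner2_swapXY. Qed.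

Lemma eval_inner_sum (I : finType) q (F : I -> {poly {poly K}}) :
  eval_inner q (\sum_i F i) = \sum_i eval_inner q (F i).
Proof. by rewrite /eval_inner rmorph_sum horner_sum. Qed.

Lemma eval_inner_map_polyC q a : eval_inner q a^:P = a.
Proof. by rewrite /eval_inner swapXY_map_polyC hornerC. Qed.

Definition eval_innerE := (eval_innerXn, eval_innerM, eval_innerD, eval_innerN,
  eval_innerC, eval_innerX).

Lemma eval_inner0_factor f : eval_inner 0 f = 0 -> exists g, f = 'X%:P * g.
Proof.
move=> f0; have [g fE] := poly_factor (swapXY f) 0; exists (swapXY g).
rewrite -[LHS]swapXYK fE [_.[0]]f0 !polyC0 subr0 add0r rmorphM /=.
by rewrite swapXY_X mulrC.
Qed.

Lemma codim_ge_swap f g n : codim_ge (swapXY f) (swapXY g) n -> codim_ge f g n.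
Proof.
case=> h free_h; exists (fun i => swapXY (h i)) => c [b [u [v [b0 bE]]]].
apply: free_h; exists (swapXY b), (swapXY u), (swapXY v).
rewrite horner2_swapXY; split=> //.
rewrite -!rmorphM -rmorphD /= -bE rmorphM rmorph_sum /=; congr (_ * _).
apply: eq_bigr => i _.
by rewrite rmorphM /= swapXYK swapXY_polyC map_polyC.
Qed.

End SwapEval.

(** * The normal form of a double point *)

Section NormalForm.
Variable K : fieldType.
Implicit Types (f g h : {poly {poly K}}) (p q a b e d w : {poly K}) (n k r : nat).

(** The expansion of f along y = p(x) that r blow-ups produce. The quadratic
    polynomial a(0) + b(0) t + g(0, 0) t^2 cuts out the points of the exceptional
    divisor of the last blow-up: distinct ones if [split], which is type
    A_(2r-1); otherwise the double root is moved to t = 0, and the condition on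
    a`_1 is the smoothness of the last strict transform, which is type A_(2r). *)
Definition A_form (split : bool) r f p a b g :=
  [/\ p.[0] = 0, g.[0, 0] != 0,
      f = ('X^(2 * r) * a)%:P + ('X^r * b)%:P * ('X - p%:P)
          + g * ('X - p%:P) ^+ 2 &
      if split then is_true (b.[0] ^+ 2 != 4%:R * a.[0] * g.[0, 0])
      else [/\ a.[0] = 0, b.[0] = 0 & a`_1 != 0]].

Lemma A_form_horner s r f p a b g d : A_form s r f p a b g ->
  f.[d] = 'X^(2 * r) * a + 'X^r * b * (d - p) + g.[d] * (d - p) ^+ 2.
Proof.
case=> _ _ {1}-> _.
by rewrite !(horner_exp, hornerM, hornerD, hornerN, hornerC, hornerX).
Qed.

(** The three terms of the normal form have orders at least 2r, r + k and exactly
    2k, where k < r. *)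
Lemma contact_below s r f p a b g d k e : A_form s r f p a b g -> d.[0] = 0 ->
    (k < r)%N -> d - p = 'X^k * e -> e.[0] != 0 ->
  exists2 w, w.[0] != 0 & f.[d] = 'X^(2 * k) * w.
Proof.
move=> nf d0 lt_kr dE e0; have [p0 g0 _ _] := nf.
have [j rE] : exists j, r = (k + j.+1)%N by exists (r - k.+1)%N; lia.
exists ('X * ('X^(j + j.+1) * a + 'X^j * b * e) + g.[d] * e ^+ 2).
  rewrite hornerD hornerM hornerX mul0r add0r hornerM horner_at0 // horner_exp.
  by rewrite mulf_neq0 // expf_neq0.
rewrite (A_form_horner d nf) dE rE !mulnDr !mul2n -!addnn !(exprD, exprS); ring.
Qed.

Lemma contact_at s r f p a b g d e : A_form s r f p a b g ->
    d - p = 'X^r * e ->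
  f.[d] = 'X^(2 * r) * (a + b * e + g.[d] * e ^+ 2).
Proof.
move=> nf dE; rewrite (A_form_horner d nf) dE mul2n -addnn exprD; ring.
Qed.

Lemma contact_dichotomy s r f p a b g d : A_form s r f p a b g -> d.[0] = 0 ->
  (exists k w, [/\ (k <= r)%N, f.[d] = 'X^(2 * k) * w & w.[0] != 0]) \/
  (exists e, [/\ d = p + 'X^r * e,
     a.[0] + b.[0] * e.[0] + g.[0, 0] * e.[0] ^+ 2 = 0 &
     'X^(2 * r + 1) %| f.[d]]).
Proof.
move=> nf d0; have [/dvdXnE[e dE]|[k [e [lt_kr dE e0]]]] := Xn_split r (d - p).
  have fd := contact_at nf dE.
  have w0 : (a + b * e + g.[d] * e ^+ 2).[0] =
      a.[0] + b.[0] * e.[0] + g.[0, 0] * e.[0] ^+ 2.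
    by rewrite !(hornerD, hornerM, horner_exp) (horner_at0 _ d0).
  have [w00|w00] := eqVneq (a + b * e + g.[d] * e ^+ 2).[0] 0.
    right; exists e; split; [by rewrite -dE subrKC|by rewrite -w0|].
    by have [w wE] := root0_factor w00; rewrite fd wE mulrA -exprSr addn1 dvdp_mulr.
  by left; exists r, (a + b * e + g.[d] * e ^+ 2).
by left; have [w w0 ->] := contact_below nf d0 lt_kr dE e0; exists k, w; rewrite ltnW.
Qed.

(** The coefficient of x^(2r+1) is a`_1, because b and e both vanish at 0. *)
Lemma cusp_contact_max r f p a b g e : A_form false r f p a b g ->
    a.[0] + b.[0] * e.[0] + g.[0, 0] * e.[0] ^+ 2 = 0 ->
  e.[0] = 0 /\ exists2 w, w.[0] != 0 & f.[p + 'X^r * e] = 'X^(2 * r + 1) * w.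
Proof.
move=> nf; have [p0 g0 _ [a0 b0 a1]] := nf.
rewrite a0 b0 mul0r !add0r => /eqP; rewrite mulf_eq0 (negPf g0) expf_eq0 /=.
move=> /eqP e0; split=> //.
have [a' aE] := root0_factor a0; have [b' bE] := root0_factor b0.
have [e' eE] := root0_factor e0.
exists (a' + 'X * (b' * e' + g.[p + 'X^r * e] * e' ^+ 2)).
  by rewrite hornerD hornerM hornerX mul0r addr0 horner0E; rewrite aE coefXM in a1.
rewrite (@contact_at _ _ _ _ _ _ _ _ e nf); last by rewrite addrC addKr.
by set G := g.[_]; rewrite addn1 [in RHS]exprSr aE bE eE; ring.
Qed.

(** On a curve x = q(y) with q of order at least 2, y - p(q(y)) is y times a unit,
    so the last term of the normal form has order 2 and the others a larger one. *)
Lemma vertical_contact s r f p a b g q : A_form s r f p a b g -> (0 < r)%N ->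
  'X^2 %| q -> exists2 w, w.[0] != 0 & eval_inner q f = 'X^2 * w.
Proof.
case=> p0 g0 fE _; case: r fE => // r fE _ /dvdXnE[q' qE].
have q0 : q.[0] = 0 by rewrite qE hornerM horner_exp hornerX expr0n mul0r.
have [p1 pE] := root0_factor p0.
pose u : {poly K} := 1 - 'X * q' * (p1 \Po q).
exists ('X^2 * q' ^+ 2 * q ^+ (2 * r) * (a \Po q)
        + 'X * q' * q ^+ r * (b \Po q) * u + eval_inner q g * u ^+ 2).
  rewrite /u !(hornerD, hornerM, hornerXn, horner_exp, hornerX, hornerN, hornerC).
  by rewrite !mul0r subr0 !add0r !mulr1 eval_inner_at0.
rewrite fE !eval_innerE pE !comp_polyM !comp_Xn_poly comp_polyX.
rewrite mulnS exprD [q ^+ r.+1]exprS; set Q := q ^+ (2 * r); set Q' := q ^+ r.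
set G := eval_inner q g; rewrite /u; set a' := a \Po q; set b' := b \Po q.
by set p' := p1 \Po q; rewrite qE; ring.
Qed.

End NormalForm.

(** * Peeling a factor x off a germ *)

Section Peeling.
Variable K : fieldType.
Implicit Types (f g h E s w u : {poly {poly K}}) (p q a b e d : {poly K}) (n k r : nat).

(** i(f, x h) >= i(f, x) + i(f, h), where i(f, x) = 2 by the shape of f: to a free
    family modulo (f, h), multiplied by x, one adds 1 and y - p. Setting x = 0 in
    a relation leaves only these two and a multiple of y^2; once their
    coefficients vanish the relation can be divided by x, which is prime and does
    not divide f. *)
Lemma codim_ge_mulX f s g p h n : p.[0] = 0 -> g.[0, 0] != 0 ->
    f = s * 'X%:P + g * ('X - p%:P) ^+ 2 ->
  codim_ge f h n -> codim_ge f ('X%:P * h) n.+2.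
Proof.
move=> p0 g0 fE [H free_H].
pose H1 m := oapp H 0 (insub m).
pose H2 m := match m with 0 => 1 | 1 => 'X - p%:P | m'.+2 => 'X%:P * H1 m' end.
exists (fun i => H2 (val i)) => c [b [u [w [b0]]]].
rewrite !big_ord_recl /= mulr1.
set S1 := \sum_(i < n) _ => bE.
pose c' i := c (lift ord0 (lift ord0 i)).
have S1E : S1 = 'X%:P * \sum_(i < n) (c' i)%:P%:P * H i.
  rewrite big_distrr; apply: eq_bigr => i _ /=.
  rewrite mulrCA; congr (_ * (_ * _)).
  by rewrite /H1 (_ : insub _ = Some i) //; exact: valK.
have ev_f : eval_inner 0 f = eval_inner 0 g * 'X^2.
  by rewrite fE !eval_innerE !comp_polyX comp_poly0r -horner0E p0 mulr0 subr0 add0r.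
have eg0 : eval_inner 0 g != 0.
  by apply: contraNneq g0 => eg; rewrite -(@eval_inner_at0 _ 0) ?horner0 // eg horner0.
have ev_bE := congr1 (eval_inner 0) bE.
rewrite S1E !eval_innerE ev_f !comp_polyX !mul0r mulr0 !comp_polyC in ev_bE.
have /dvdXnP c01 : 'X^2 %| (c ord0)%:P + (c (lift ord0 ord0))%:P * 'X.
  apply: (@dvdXn_unitl _ _ (eval_inner 0 b)); first by rewrite eval_inner_at0 ?horner0.
  move: ev_bE; rewrite comp_poly0r -horner0E p0 subr0 !addr0 => ->.
  by rewrite mulrA dvdp_mull.
have c0 : c ord0 = 0 by have := c01 0%N isT; rewrite coefD coefMX !coefC addr0.
have c1 : c (lift ord0 ord0) = 0.
  by have := c01 1%N isT; rewrite coefD coefMX !coefC add0r.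
move: ev_bE; rewrite c0 c1 !mul0r !addr0 mulr0 => /esym/eqP.
rewrite mulf_eq0 mulf_eq0 (negPf eg0) (negPf (Xn_neq0 _ _)) !orbF => /eqP u0.
have [u' uE] := eval_inner0_factor u0.
have free_c' : forall i, c' i = 0.
  apply: free_H; exists b, u', w; split=> //.
  have X0 : 'X%:P != 0 :> {poly {poly K}} by rewrite polyC_eq0 polyX_eq0.
  apply: (mulfI X0); rewrite mulrCA -S1E.
  move: bE; rewrite c0 c1 !polyC0 !mul0r !add0r => ->.
  by rewrite uE; ring.
move=> i; case: (unliftP ord0 i) => [j ->|->//].
by case: (unliftP ord0 j) => [l ->|->//]; exact: free_c'.
Qed.

(** i(f, x h) <= i(f, x) + i(f, h): being divisible by y^2 after setting x = 0 is
    two linear conditions, so n + 2 free elements have n free combinations that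
    satisfy them; up to a unit and modulo f, these are x times elements that are
    free modulo (f, h). *)
Lemma codim_ge_divX f s g p h n : p.[0] = 0 -> g.[0, 0] != 0 ->
    f = s * 'X%:P + g * ('X - p%:P) ^+ 2 ->
  codim_ge f ('X%:P * h) n.+2 -> codim_ge f h n.
Proof.
move=> p0 g0 fE [H free_H].
pose M : 'M[K]_(n.+2, 2) := \matrix_(i, j) (eval_inner 0 (H i))`_j.
pose B := row_base (kermx M).
have le_nB : (n <= \rank (kermx M))%N.
  by rewrite mxrank_ker; have := rank_leq_col M; lia.
apply: (codim_ge_le le_nB).
have BM : B *m M = 0.
  by apply/sub_kermxP; rewrite eq_row_base.
pose H' j := \sum_i (B j i)%:P%:P * H i.
have /fin_all_exists[w] : forall j, exists w, exists t,
    g * H' j = t * f + 'X%:P * w.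
  move=> j; have /dvdXnE[t tE] : 'X^2 %| eval_inner 0 (H' j).
    apply/dvdXnP => k lt_k2.
    have /matrixP/(_ j (Ordinal lt_k2)) := BM; rewrite !mxE => BMj; rewrite -[RHS]BMj.
    rewrite /H' eval_inner_sum coef_sum; apply: eq_bigr => i _.
    by rewrite !eval_innerE comp_polyC coefCM [M _ _]mxE.
  have [w wE] : exists w, H' j - ('X - p%:P) ^+ 2 * t^:P = 'X%:P * w.
    apply: eval_inner0_factor; rewrite !eval_innerE tE eval_inner_map_polyC.
    by rewrite comp_poly0r -horner0E p0 subr0 subrr.
  exists (g * w - s * t^:P), t^:P.
  rewrite -[H' j](subrK (('X - p%:P) ^+ 2 * t^:P)) wE fE; ring.
move=> /fin_all_exists[t wE].
exists w => c [b [u [v [b0 bE]]]].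
have cB : (\row_j c j) *m B = 0.
  apply/rowP => i; rewrite [RHS]mxE.
  apply: (free_H (fun i => ((\row_j c j) *m B) ord0 i)).
  have -> : \sum_i (((\row_j c j) *m B) ord0 i)%:P%:P * H i =
      \sum_j (c j)%:P%:P * H' j.
    under [RHS]eq_bigr do rewrite big_distrr.
    rewrite exchange_big; apply: eq_bigr => l _; rewrite mxE.
    rewrite !rmorph_sum big_distrl; apply: eq_bigr => j _.
    by rewrite mxE /= !polyCM mulrA.
  exists (b * g), (b * (\sum_j (c j)%:P%:P * t j) + 'X%:P * u), v.
  split; first by rewrite horner00M mulf_neq0.
  have sumE : g * (\sum_j (c j)%:P%:P * H' j) =
      (\sum_j (c j)%:P%:P * t j) * f + 'X%:P * \sum_j (c j)%:P%:P * w j.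
    rewrite mulr_suml !mulr_sumr -big_split; apply: eq_bigr => j _ /=.
    by rewrite mulrCA wE; ring.
  transitivity (b * (\sum_j (c j)%:P%:P * t j) * f
      + 'X%:P * (b * \sum_j (c j)%:P%:P * w j)).
    by rewrite -mulrA sumE; ring.
  by rewrite bE; ring.
have freeB : row_free B by exact: row_base_free.
have /eqP := cB; rewrite -(mul0mx _ B) (inj_eq (row_free_inj freeB)).
by move=> /eqP/rowP c0 j; have := c0 j; rewrite !mxE.
Qed.

End Peeling.

(** * Singular curves through a cusp *)

Section Cusp.
Variable K : fieldType.
Implicit Types (al be f g h E s w u : {poly {poly K}}) (p q a b e d : {poly K}) (n k r : nat).

Lemma codim_ge_transfer f g g' u w n : u.[0, 0] != 0 -> u * g' = w * f + g ->
  codim_ge f g' n <-> codim_ge f g n.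
Proof.
move=> u0 ug'; split; apply: codim_ge_sub => h.
  apply: (@local_mem_equiv _ _ _ _ (- w) u 1).
    by rewrite horner00 coef1 /= coef1 oner_eq0.
  by rewrite ug'; ring.
by apply: (@local_mem_equiv _ _ _ _ w 1 u _ u0); rewrite ug' mul1r.
Qed.

Variables (r : nat) (f g : {poly {poly K}}) (p a b : {poly K}).
Hypotheses (nf : A_form false r f p a b g) (r_gt0 : (0 < r)%N).

Let v := 'X - p%:P.
Let x : {poly {poly K}} := 'X%:P.

(** Write be = x be1 + be2 (y - p). Multiplying by the unit g turns be2 (y - p)^2
    into be2 f minus terms divisible by x^(r+1), so the germ becomes divisible
    by x modulo f. *)
Lemma peel_step k al be : (k <= r)%N -> be.[0, 0] = 0 ->
  exists al' be', al'.[0, 0] = g.[0, 0] * al.[0, 0] /\ forall n,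
    codim_ge f (al * x ^+ k.+1 + be * v) n.+2 <->
    codim_ge f (al' * x ^+ k + be' * v) n.
Proof.
move=> le_kr be0; have [p0 g0 fE [a0 b0 _]] := nf.
have [be2 beE] := poly_factor be p.
have [be1 be1E] : exists e, be.[p] = 'X * e.
  by apply: root0_factor; rewrite (horner_at0 _ p0).
have [a' aE] := root0_factor a0; have [b' bE] := root0_factor b0.
exists (g * al - be2 * a'%:P * x ^+ (2 * r - k)), (g * be1%:P - be2 * b'%:P * x ^+ r).
split.
  rewrite /x !(hornerD, hornerN, horner_exp, hornerM, hornerC, hornerX).
  have -> : (2 * r - k)%N = (2 * r - k).-1.+1 by lia.
  by rewrite expr0n mulr0 subr0.
move=> n; set E' := (X in _ <-> codim_ge f X n).
have fE' : f = ((a'%:P * x ^+ (2 * r)) + b'%:P * x ^+ r * v) * 'X%:P + g * v ^+ 2.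
  by rewrite [LHS]fE aE bE !polyCM !polyC_exp -/x -/v; ring.
rewrite (@codim_ge_transfer _ (x * E') _ g be2) //; last first.
  have -> : f = ((a'%:P * x ^+ (2 * r)) + b'%:P * x ^+ r * v) * x + g * v ^+ 2 by [].
  rewrite /E' beE be1E polyCM -/x -/v.
  have -> : (2 * r = (2 * r - k) + k)%N by lia.
  by rewrite addnK exprD exprS; ring.
split; first exact: (codim_ge_divX p0 g0 fE').
exact: (codim_ge_mulX p0 g0 fE').
Qed.

(** When be is a unit the germ is the smooth curve y = p - (al / be) x^k + ..., and
    its contact with f is computed on its graph. *)
Lemma cusp_codim_smooth k al be : (0 < k <= r)%N -> be.[0, 0] != 0 ->
  codim_ge f (al * x ^+ k + be * v) (2 * k) /\
  (al.[0, 0] != 0 -> ~ codim_ge f (al * x ^+ k + be * v) (2 * k).+1).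
Proof.
move=> /andP[k_gt0 le_kr] be0; have [p0 g0 fE [a0 b0 _]] := nf.
set E := al * _ + _.
have E0 : E.[0, 0] = 0.
  rewrite /E /x /v !(hornerD, hornerN, horner_exp, hornerM, hornerC, hornerX).
  by rewrite p0 subr0 mulr0 addr0 expr0n eqn0Ngt k_gt0 mulr0.
have E'0 : E^`().[0, 0] = be.[0, 0].
  rewrite /E /x /v -polyC_exp !poly.derivE !(hornerD, hornerN, hornerM, hornerC, hornerX).
  by rewrite hornerXn p0 subr0 !mulr0 expr0n eqn0Ngt k_gt0 mulr0 !add0r mulr1.
have E'n0 : E^`().[0, 0] != 0 by rewrite E'0.
have [] := picard_graph (2 * r).+1 E0 E'n0; set d := picard _ _ => d0 Ed.
have {}Ed m : (m <= (2 * r).+2)%N -> 'X^m %| E.[d].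
  by move=> le_m; apply: dvdp_trans Ed; rewrite dvdp_exp2l.
have EdE : E.[d] = al.[d] * 'X^k + be.[d] * (d - p).
  by rewrite /E /x /v !(hornerD, hornerN, horner_exp, hornerM, hornerC, hornerX).
have /dvdXnE[q qE] : 'X^k %| d - p.
  apply: (@dvdXn_unitl _ _ be.[d]); first by rewrite horner_at0.
  rewrite [X in _ %| X](_ : _ = E.[d] - al.[d] * 'X^k); last by rewrite EdE; ring.
  by rewrite dvdp_sub ?dvdp_mulIr // Ed //; lia.
have fd : exists w : {poly K}, f.[d] = 'X^(2 * k) * w /\ w.[0] = g.[0, 0] * q.[0] ^+ 2.
  have rE : (2 * r = 2 * k + 2 * (r - k))%N by lia.
  have rE' : (2 * k + (r - k) = r + k)%N by lia.
  exists ('X^(2 * (r - k)) * a + 'X^(r - k) * b * q + g.[d] * q ^+ 2).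
  rewrite !(hornerD, hornerM) a0 b0 horner_exp (horner_at0 _ d0) !mulr0 mul0r !add0r.
  split=> //; rewrite (A_form_horner d nf) qE rE !mulrDr !mulrA -!exprD rE'.
  by rewrite mul2n -addnn !exprD; ring.
have [w [fdE w0]] := fd.
split.
  by apply: (codim_ge_graph d0); rewrite ?fdE ?dvdp_mulr // Ed //; lia.
move=> al0; apply: (codim_lt_graph E'n0 d0 _ fdE); first by rewrite Ed //; lia.
rewrite w0 mulf_neq0 // expf_neq0 //; apply: contraNneq al0 => q0.
have /dvdXnP/(_ k (ltnSn k)) : 'X^(k.+1) %| E.[d] by rewrite Ed //; lia.
rewrite EdE qE mulrC mulrCA -mulrDr coef_XnM_lead hornerD hornerM q0 mulr0 addr0.
by rewrite (horner_at0 _ d0) => ->.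
Qed.

(** Either the germ is smooth, or [peel_step] removes a factor x and two units of
    intersection number. *)
Lemma cusp_codim k al be : (k <= r)%N ->
  codim_ge f (al * x ^+ k + be * v) (2 * k) /\
  (al.[0, 0] != 0 -> ~ codim_ge f (al * x ^+ k + be * v) (2 * k).+1).
Proof.
have [p0 g0 _ _] := nf.
elim: k al be => [|k IHk] al be le_kr.
  split; first exact: codim_ge0.
  move=> al0 /codim_ge_unit unitE; suff /unitE : (al * x ^+ 0 + be * v).[0, 0] != 0 by [].
  rewrite /v expr0 mulr1 !(hornerD, hornerN, hornerM, hornerC, hornerX) p0.
  by rewrite subr0 mulr0 addr0.
have [be0|be0] := eqVneq be.[0, 0] 0; last by apply: cusp_codim_smooth.
have [al' [be' [al'0 step]]] := peel_step al (ltnW le_kr) be0.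
have [ge lt] := IHk al' be' (ltnW le_kr).
rewrite mulnS; split; first by apply/step.
by move=> al0 /step; apply: lt; rewrite al'0 mulf_neq0.
Qed.

(** Expand E = E(x, p) + W (y - p). If E(x, p) has order k <= r, the intersection
    number is 2k; if the order is larger and W is not a unit, one peeling step
    already gives at least 2 + 2r. *)
Lemma cusp_odd_smooth E :
    codim_ge f E (2 * r).+1 -> ~ codim_ge f E (2 * r).+2 ->
  E.[0, 0] = 0 /\ E^`().[0, 0] != 0.
Proof.
have [p0 g0 _ _] := nf; have [W EE] := poly_factor E p => geE ltE.
have [/dvdXnE[e eE]|[k [e [lt_kr eE e0]]]] := Xn_split r.+1 E.[p]; last first.
  have [_ lt] := cusp_codim e%:P W lt_kr.
  have /lt[] : (e%:P).[0, 0] != 0 by rewrite !hornerC.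
  have <- : E = e%:P * x ^+ k + W * v.
    by rewrite [LHS]EE eE polyCM polyC_exp [in RHS]mulrC.
  by apply: codim_ge_le geE; lia.
split.
  by rewrite -(horner_at0 _ p0) eE hornerM horner_exp hornerX expr0n mul0r.
rewrite -(horner_at0 _ p0) {1}EE !poly.derivE.
rewrite !(hornerD, hornerN, hornerM, hornerC, hornerX).
rewrite subrr mulr0 !add0r mulr1 (horner_at0 _ p0).
apply: contra_notN ltE => /eqP W0.
have [al' [be' [_ /(_ (2 * r)%N) step]]] := peel_step e%:P (leqnn r) W0.
have -> : E = e%:P * x ^+ r.+1 + W * v.
  by rewrite [LHS]EE eE polyCM polyC_exp [in RHS]mulrC.
by apply/step; have [] := cusp_codim al' be' (leqnn r).
Qed.

End Cusp.

Lemma coef_expansion2 (R : comNzRingType) (u v : R) (w : {poly R}) :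
  [/\ (u%:P + v%:P * 'X + w * 'X ^+ 2)`_0 = u,
      (u%:P + v%:P * 'X + w * 'X ^+ 2)`_1 = v &
      (u%:P + v%:P * 'X + w * 'X ^+ 2)`_2 = w`_0].
Proof.
by split; rewrite !coefD coefC coefMX coefC coefMXn /= ?addr0 ?add0r.
Qed.

(** * The normal form under blowing down *)

Section BlowUpChart.
Variable K : fieldType.
Implicit Types (f g h : {poly {poly K}}) (p q a b e d : {poly K}) (n k r m : nat) (t : K).

(** The chart y = x (Y + t) of the blow-up of the origin. *)
Definition chart_map t : {poly {poly K}} := 'X%:P * 'X + ('X * t%:P)%:P.

Lemma deriv_coef00 f : f^`().[0, 0] = f`_1`_0.
Proof. by rewrite horner00 coef_deriv mulr1n. Qed.

Lemma eval_inner0_coef f j : (eval_inner 0 f)`_j = f`_j`_0.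
Proof. by rewrite /eval_inner horner_coef0 coef_swapXY. Qed.

Lemma eval_inner0_chart t f : eval_inner 0 (f \Po chart_map t) = (f.[0, 0])%:P.
Proof.
have [g fE] := poly_factor f 0.
rewrite {1}fE polyC0 subr0 comp_polyD comp_polyM comp_polyC comp_polyX.
rewrite eval_innerD eval_innerM !eval_innerE !comp_polyM !comp_polyX.
by rewrite !mul0r addr0 mulr0 addr0 comp_poly0r -horner0E.
Qed.

Lemma double_expansion f : (forall i j, (i + j < 2)%N -> f`_i`_j = 0) ->
  exists a b g, [/\ f = ('X^2 * a)%:P + ('X * b)%:P * 'X + g * 'X ^+ 2,
    a.[0] = f`_0`_2, b.[0] = f`_1`_1 & g.[0, 0] = f`_2`_0].
Proof.
move=> f0; have [g fE] := poly_taylor2 f 0.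
have /dvdXnE[a aE] : 'X^2 %| f.[0].
  by apply/dvdXnP => i lt_i2; rewrite horner_coef0 f0.
have /root0_factor[b bE] : f^`().[0].[0] = 0.
  by rewrite -polyC0 deriv_coef00 f0.
rewrite aE bE polyC0 subr0 in fE; exists a, b, g; split=> //.
- by rewrite -(coef_XnM_lead 2 a) -aE horner_coef0.
- rewrite -(coef_XnM_lead 1 b) expr1 -bE horner_coef0 coef_deriv.
  by rewrite mulr1n.
- by have [_ _] := coef_expansion2 ('X^2 * a) ('X * b) g; rewrite -fE horner00 => ->.
Qed.

Lemma double_pullback t f : (forall i j, (i + j < 2)%N -> f`_i`_j = 0) ->
  exists g, [/\ f \Po chart_map t = ('X^2)%:P * g,
    g`_0`_0 = f`_0`_2 + f`_1`_1 * t + f`_2`_0 * t ^+ 2,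
    g`_1`_0 = f`_1`_1 + f`_2`_0 * t *+ 2 & g`_2`_0 = f`_2`_0].
Proof.
move=> /double_expansion[a [b [g [fE <- <- <-]]]].
exists (a%:P + b%:P * ('X + t%:P%:P) + (g \Po chart_map t) * ('X + t%:P%:P) ^+ 2).
set h := (X in _ = _ * X).
have hE : eval_inner 0 h = (a.[0])%:P + (b.[0])%:P * ('X + t%:P)
    + (g.[0, 0])%:P * ('X + t%:P) ^+ 2.
  rewrite /h !eval_innerE eval_inner0_chart !comp_polyC !comp_poly0r -!horner0E.
  by [].
have hE' : eval_inner 0 h = (a.[0] + b.[0] * t + g.[0, 0] * t ^+ 2)%:P
    + (b.[0] + g.[0, 0] * t *+ 2)%:P * 'X + (g.[0, 0])%:P * 'X ^+ 2.
  by rewrite hE mulr2n !polyCD !polyCM; ring.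
split.
- rewrite fE ?expr2 !comp_polyD !comp_polyM !comp_polyC comp_polyX.
  by rewrite /h /chart_map !polyCM; ring.
all: rewrite -eval_inner0_coef hE'.
- by case: (coef_expansion2 (a.[0] + b.[0] * t + g.[0, 0] * t ^+ 2)
    (b.[0] + g.[0, 0] * t *+ 2) (g.[0, 0])%:P).
- by case: (coef_expansion2 (a.[0] + b.[0] * t + g.[0, 0] * t ^+ 2)
    (b.[0] + g.[0, 0] * t *+ 2) (g.[0, 0])%:P).
- by case: (coef_expansion2 (a.[0] + b.[0] * t + g.[0, 0] * t ^+ 2)
    (b.[0] + g.[0, 0] * t *+ 2) (g.[0, 0])%:P) => _ _ ->; rewrite coefC.
Qed.

(** The curve Y = p(x) upstairs is y = x (t + p(x)) downstairs, and the coefficients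
    of the expansion along it are multiplied by x^2, x and 1. *)
Lemma A_form_blowdown s r t f g p a b h :
    f \Po chart_map t = ('X^2)%:P * g -> A_form s r g p a b h ->
  exists h', A_form s r.+1 f ('X * (t%:P + p)) a b h'.
Proof.
move=> fg [p0 h0 gE dE]; set P := 'X * _.
have P0 : P.[0] = 0 by rewrite hornerM hornerX mul0r.
have [h' fE] := poly_taylor2 f P; exists h'.
have chart_p : (chart_map t).[p] = P.
  by rewrite /chart_map !(hornerD, hornerM, hornerC, hornerX) /P; ring.
have fP : f.[P] = 'X^(2 * r.+1) * a.
  have := congr1 (fun u => u.[p]) fg; rewrite horner_comp chart_p => ->.
  rewrite hornerM hornerC gE !(hornerD, hornerM, hornerC, hornerX, horner_exp, hornerN).
  by rewrite mulnS exprD; ring.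
have f'P : f^`().[P] = 'X^(r.+1) * b.
  have := congr1 (fun u => u^`().[p]) fg; rewrite deriv_comp hornerM horner_comp chart_p.
  rewrite /chart_map gE !poly.derivE.
  rewrite !(hornerD, hornerM, hornerC, hornerX, horner_exp, hornerN) => eq_x.
  apply: (mulfI (negbT (polyX_eq0 K))); rewrite mulrC.
  move: eq_x; rewrite !mul0r !addr0 !mulr1 => ->.
  by rewrite [in RHS]exprS; ring.
have hE : h' \Po chart_map t = h.
  have x2 : ('X^2)%:P * ('X - p%:P) ^+ 2 != 0 :> {poly {poly K}}.
    by rewrite mulf_neq0 ?polyC_eq0 ?Xn_neq0 // expf_neq0 ?polyXsubC_eq0.
  have := fg; rewrite {1}fE fP f'P gE.
  have -> : ('X^(2 * r.+1) * a)%:P = 'X%:P * 'X%:P * ('X^(2 * r) * a)%:P.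
    by rewrite mulnS exprD expr2 -!mulrA !polyCM.
  have -> : ('X^(r.+1) * b)%:P = 'X%:P * ('X^r * b)%:P :> {poly {poly K}}.
    by rewrite exprS -!mulrA !polyCM.
  rewrite !expr2 in x2 *.
  rewrite !comp_polyD !comp_polyM !comp_polyC !rmorphB /= comp_polyX comp_polyC.
  have -> : chart_map t - P%:P = 'X%:P * ('X - p%:P).
    by rewrite /chart_map /P !(polyCM, polyCD); ring.
  move: ('X^(2 * r) * a)%:P ('X^r * b)%:P => A B.
  set w := 'X - p%:P; set x := 'X%:P in x2 *; rewrite polyCM -/x in x2 * => eq_fg.
  apply: (mulIf x2); apply: (addrI (x * x * A + x * B * (x * w))).
  rewrite -/w [RHS](_ : _ = x * x * (A + B * w + h * (w * w))); last by ring.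
  by rewrite -eq_fg; ring.
have h'0 : h'.[0, 0] = h.[0, 0].
  by rewrite -hE -(@eval_inner_at0 _ 0 (h' \Po _)) ?horner0 // eval_inner0_chart hornerC.
by rewrite /A_form P0 h'0; split=> //; rewrite {1}fE fP f'P.
Qed.

(** The induction over the blow-ups starts at r = 0, with a strict transform that
    is smooth and tangent to the exceptional divisor. *)
Lemma A_form_smooth g : (forall i j, (i + j < 1)%N -> g`_i`_j = 0) ->
    g`_1`_0 = 0 -> g`_0`_1 != 0 -> g`_2`_0 != 0 ->
  exists a b h, A_form false 0 g 0 a b h.
Proof.
move=> g0 g10 g01 g20; have [h gE] := poly_taylor2 g 0.
exists g.[0], g^`().[0], h.
have h00 : h.[0, 0] = g`_2`_0.
  have [_ _] := coef_expansion2 g.[0] g^`().[0] h.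
  by rewrite polyC0 subr0 in gE; rewrite -gE horner00 => ->.
split; rewrite ?horner0 ?h00 ?expr0 ?mul1r //.
split; last by rewrite horner_coef0.
  by have := horner00 g; rewrite polyC0 g0.
by have := deriv_coef00 g; rewrite polyC0 g10.
Qed.

Lemma horner_map_polyC p q : (p^:P).[q] = p \Po q.
Proof. by []. Qed.

(** The curve y = p(x), with p of slope t <> 0, is also the graph x = q(y) of the
    inverse series. Along it f still vanishes to order 2r, and f_x vanishes to order
    r because f_x = d/dx f(x, p) - p' f_y. The quadratic polynomial is the old one
    up to scaling its values and its variable. The case of two branches with r = 1
    is excluded: there the tangent cone is not the square of one linear form, and
    f may lack the term x^2. *)
Lemma A_form_swap s r f p a b g t :
    A_form s r (swapXY f) p a b g -> p`_1 = t -> t != 0 -> (0 < r)%N ->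
    ~~ s \/ (1 < r)%N ->
  exists q a' b' g', A_form s r f q a' b' g'.
Proof.
move=> [p0 g0 fE dE] p1 t0 r_gt0 sr.
pose c : {poly {poly K}} := 'Y - p^:P.
have c0 : c.[0, 0] = 0.
  by rewrite /c hornerD hornerN hornerC horner_map hornerD hornerN hornerX hornerC p0 subrr.
have c'0 : c^`().[0, 0] = - t.
  rewrite /c !poly.derivE deriv_map hornerD hornerN horner0 horner_map hornerD hornerN.
  by rewrite horner0 hornerC horner0E coef_deriv p1 add0r.
have c'n0 : c^`().[0, 0] != 0 by rewrite c'0 oppr_eq0.
(* order 2r + 2 leaves the coefficient of y^(2r+1) in f(q(y), y) intact *)
have [] := picard_graph (2 * r + 1) c0 c'n0; set q := picard _ _ => q0 /dvdXnE[e].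
have cq : c.[q] = 'X - (p \Po q) by rewrite /c hornerD hornerN hornerC.
rewrite cq => cqE.
have [q1 qE] := root0_factor q0.
have [p2 pE] := root0_factor p0.
have p20 : p2.[0] = t by rewrite -p1 pE coefXM horner0E.
have q10 : q1.[0] != 0.
  have : 'X * (1 - q1 * (p2 \Po q)) = 'X * ('X^((2 * r + 1)) * e).
    rewrite mulrA -exprS -cqE pE comp_polyM comp_polyX.
    by set P2 := p2 \Po q; rewrite qE; ring.
  move/(mulfI (negbT (polyX_eq0 K)))/(congr1 (horner^~ 0)) => /=.
  rewrite hornerM hornerXn expr0n addn1 mul0r hornerD hornerN hornerM hornerC.
  rewrite horner_comp q0 p20 => /eqP; apply: contraTneq => ->.
  by rewrite mul0r subr0 oner_eq0.
pose G := swapXY g.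
have fE' : f = ('X^(2 * r) * a)^:P + ('X^r * b)^:P * c + G * c ^+ 2.
  rewrite -[LHS]swapXYK fE !expr2.
  move: ('X^(2 * r) * a) ('X^r * b) => A B.
  by rewrite !rmorphD !rmorphM /= swapXY_is_zmod_morphism !swapXY_polyC swapXY_X.
have c'E : c^`() = - (p^`())^:P by rewrite /c !poly.derivE deriv_map add0r.
clearbody q c.
have r1E : r = r.-1.+1 by case: (r) r_gt0.
set r1 := r.-1 in r1E.
(* for r = 1 the terms below are divisible by x only thanks to a(0) = b(0) = 0 *)
have sr' : ~~ s \/ (0 < r1)%N by case: sr; [left|right; lia].
have ab0 : ~~ s -> a.[0] = 0 /\ b.[0] = 0 by case: (s) dE => // -[].
have [u uE] : exists u, 'X^r1 * a = 'X * u.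
  apply: root0_factor; rewrite hornerM hornerXn expr0n.
  by case: sr' => [/ab0[-> _]|]; rewrite ?mulr0 //; case: (r1) => // *; rewrite mul0r.
have [w wE] : exists w, 'X^r1 * b = 'X * w.
  apply: root0_factor; rewrite hornerM hornerXn expr0n.
  by case: sr' => [/ab0[_ ->]|]; rewrite ?mulr0 //; case: (r1) => // *; rewrite mul0r.
pose a' := q1 ^+ (2 * r) * (a \Po q) +
    'X^2 * (q ^+ r * (b \Po q) * e + G.[q] * 'X^((2 * r).+2) * e ^+ 2).
have qn n : q ^+ n = 'X^n * q1 ^+ n by rewrite qE exprMn.
have Xq n (h : {poly K}) : ('X^n * h) \Po q = q ^+ n * (h \Po q).
  by rewrite comp_polyM comp_Xn_poly.
have fq : f.[q] = 'X^(2 * r) * a'.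
  rewrite fE' !(hornerD, hornerM, horner_exp) !horner_map_polyC.
  rewrite [c.[q]]cq cqE addn1 !Xq [in LHS]qn /a'.
  move: (a \Po q) (b \Po q) G.[q] => A B C.
  have -> : 'X^((2 * r).+2) = 'X^(2 * r) * 'X^2 :> {poly K} by rewrite -exprD addn2.
  ring.
pose D := a *+ (2 * r) + 'X * a^`().
have DE : ('X^(2 * r) * a)^`() = 'X^(r + r1) * D.
  rewrite derivM derivXn /D (_ : (2 * r).-1 = (r + r1)%N); last by lia.
  rewrite (_ : (2 * r)%N = (r + r1).+1) ?exprS; last by lia.
  by rewrite mulrDr mulrnAl mulrnAr; ring.
have D0 : D.[0] = a.[0] *+ (2 * r).
  by rewrite /D hornerD hornerMn hornerM hornerX mul0r addr0.
clearbody D.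
pose b' : {poly K} := 'X^r1 * q1 ^+ (r + r1) * (D \Po q)
  - q1 ^+ r * (b \Po q) * (p^`() \Po q)
  + 'X * ('X^(r.+1) * ((('X^r * b)^`() \Po q) * e
    + G^`().[q] * 'X^((2 * r).+2) * e ^+ 2 - (G.[q] * e * (p^`() \Po q)) *+ 2)).
have f'q : f^`().[q] = 'X^r * b'.
  rewrite fE' !(derivD, derivM, deriv_exp) !deriv_map c'E.
  rewrite !(hornerD, hornerM, horner_exp, hornerN) !horner_map_polyC DE !Xq.
  rewrite [c.[q]]cq cqE addn1 [q ^+ r]qn [q ^+ (r + r1)]qn exprD /b'.
  move: (D \Po q) (b \Po q) G.[q] G^`().[q] (p^`() \Po q) (_^`() \Po q).
  move=> D' B G0 G1 p' B'.
  have -> : 'X^((2 * r).+2) = 'X * 'X^r * 'X^(r.+1) :> {poly K}.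
    by rewrite -exprS -exprD; congr (_ ^+ _); lia.
  by rewrite mulr2n exprS; ring.
have p'0 : (p^`()).[0] = t by rewrite horner0E coef_deriv p1.
have b'0 : b'.[0] = - (q1.[0] ^+ r * b.[0] * t).
  rewrite /b' !(hornerD, hornerM, horner_exp, hornerN, horner_comp, hornerX) q0 p'0.
  rewrite mul0r addr0 (_ : _ * _ * D.[0] = 0) ?add0r //.
  rewrite D0; have := congr1 (horner^~ 0) uE.
  rewrite /= !(hornerM, horner_exp, hornerX) mul0r => u0.
  by rewrite mulrAC mulrnAr u0 mul0rn mul0r.
have a'0 : a'.[0] = q1.[0] ^+ (2 * r) * a.[0].
  rewrite /a' !(hornerD, hornerM, horner_exp, hornerX, horner_comp) q0.
  by rewrite mul0r mul0r addr0.
have [g' fT] := poly_taylor2 f q.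
have g'0 : g'.[0, 0] = t ^+ 2 * g.[0, 0].
  have evf : eval_inner 0 f = 'X^2 * ('X * ('X^r1 * u - w * p2) + g.[0] * p2 ^+ 2).
    rewrite /eval_inner fE !(hornerD, hornerM, horner_exp, hornerN, hornerC, hornerX).
    have -> : 'X^(2 * r) * a = 'X^2 * ('X * ('X^r1 * u)).
      by rewrite ['X * (_ * u)]mulrCA -uE mul2n -addnn exprD r1E !exprS; ring.
    have -> : 'X^r * b = 'X * ('X * w) by rewrite -wE r1E exprS mulrA.
    by rewrite pE; ring.
  have : (eval_inner 0 f)`_2 = g'.[0, 0].
    rewrite fT !eval_innerE !comp_poly0r -!horner0E q0 subr0.
    case: (coef_expansion2 f.[q].[0] f^`().[q].[0] (eval_inner 0 g')) => _ _ ->.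
    by rewrite -horner0E eval_inner_at0 ?horner0.
  rewrite evf coef_XnM_lead hornerD hornerM hornerX mul0r add0r hornerM => <-.
  by rewrite horner_exp p20 mulrC polyC0.
exists q, a', b', g'; split => //.
- by rewrite g'0 mulf_neq0 // expf_neq0.
- by rewrite -fq -f'q.
case: (s) dE => [|[a0 b0 a1]].
  rewrite a'0 b'0 g'0 => dE.
  rewrite -subr_eq0 (_ : _ - _ =
    (q1.[0] ^+ r * t) ^+ 2 * (b.[0] ^+ 2 - 4%:R * a.[0] * g.[0, 0])).
    by rewrite mulf_neq0 ?subr_eq0 // expf_neq0 // mulf_neq0 // expf_neq0.
  by rewrite mul2n -addnn exprD; ring.
rewrite a'0 b'0 a0 b0 !(mulr0, mul0r) oppr0; split => //.
have [a2 aE] := root0_factor a0.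
have -> : a' = 'X * (q1 ^+ (2 * r) * q1 * (a2 \Po q) +
    'X * (q ^+ r * (b \Po q) * e + G.[q] * 'X^((2 * r).+2) * e ^+ 2)).
  rewrite /a' aE comp_polyM comp_polyX.
  move: (a2 \Po q) (b \Po q) G.[q] (q ^+ r) => A B C Q.
  by rewrite qE; ring.
rewrite coefXM /= -horner0E !(hornerD, hornerM, horner_exp, hornerX, horner_comp).
rewrite q0 mul0r addr0.
by move: a1; rewrite aE coefXM -horner0E => a1; rewrite !mulf_neq0 // expf_neq0.
Qed.

End BlowUpChart.

(** * From the resolution to the normal form *)

Section Subst2.
Variable K : fieldType.
Implicit Types (f g h u v : {poly {poly K}}) (c : K).

Lemma subst2_is_zmod_morphism u v : zmod_morphism (subst2 u v).
Proof. by move=> f g; rewrite /subst2 rmorphB !hornerD !hornerN. Qed.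

Lemma subst2_is_monoid_morphism u v : monoid_morphism (subst2 u v).
Proof.
split; first by rewrite /subst2 rmorph1 -[1]polyC1 hornerC hornerC.
by move=> f g; rewrite /subst2 rmorphM !hornerM.
Qed.

HB.instance Definition _ u v := GRing.isZmodMorphism.Build {poly {poly K}}
  {poly {poly K}} (subst2 u v) (subst2_is_zmod_morphism u v).
HB.instance Definition _ u v := GRing.isMonoidMorphism.Build {poly {poly K}}
  {poly {poly K}} (subst2 u v) (subst2_is_monoid_morphism u v).

Lemma subst2C u v c : subst2 u v c%:P%:P = c%:P%:P.
Proof.
rewrite /subst2 map_polyC hornerC.
have E := map_polyC (@polyC {poly K} \o @polyC K : {rmorphism K -> {poly {poly K}}}) c.
exact: etrans (congr1 (fun p : {poly {poly {poly K}}} => p.[v]) E) (hornerC _ _).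
Qed.

Lemma subst2X u v : subst2 u v 'X = u.
Proof. by rewrite /subst2 map_polyX hornerX hornerC. Qed.

Lemma subst2Y u v : subst2 u v 'Y = v.
Proof.
rewrite /subst2 map_polyC hornerC.
have E := map_polyX (@polyC {poly K} \o @polyC K : {rmorphism K -> {poly {poly K}}}).
exact: etrans (congr1 (fun p : {poly {poly {poly K}}} => p.[v]) E) (hornerX _).
Qed.

(** K[x, y] is generated by the constants and the two variables. *)
Lemma poly2_morph_ext (S : nzRingType) (F G : {rmorphism {poly {poly K}} -> S}) :
    (forall c, F c%:P%:P = G c%:P%:P) -> F 'X = G 'X -> F 'Y = G 'Y -> F =1 G.
Proof.
move=> eqC eqX eqY; elim/poly_ind => [|f p IHf]; first by rewrite !rmorph0.
rewrite !rmorphD !rmorphM /= IHf eqX; congr (_ + _).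
elim/poly_ind: p => [|p c IHp]; first by rewrite !rmorph0.
by rewrite !(polyCD, polyCM) !rmorphD !rmorphM /= IHp eqY eqC.
Qed.

End Subst2.

Section BlowUps.
Variable K : fieldType.
Implicit Types (f g h u v : {poly {poly K}}) (c t : K) (d : option K).

(** The two kinds of charts of the blow-up differ by the exchange of the variables;
    after [in_chart] both have the exceptional divisor x = 0, with x inner. *)
Definition in_chart d f := if d is Some _ then swapXY f else f.
Definition chart_slope d : K := if d is Some t then t else 0.

Lemma in_chartK d : involutive (in_chart d).
Proof. by case: d => //= t; exact: swapXYK. Qed.

Lemma in_chart_at00 d f : (in_chart d f).[0, 0] = f.[0, 0].
Proof. by case: d => //= t; rewrite horner2_swapXY. Qed.

Lemma blowup_pullbackE d f :
  in_chart d (blowup_pullback d f) = in_chart d f \Po chart_map (chart_slope d).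
Proof.
case: d => [t|] /=.
- pose F : {rmorphism {poly {poly K}} -> {poly {poly K}}} :=
    swapXY \o subst2 'X ('X * ('Y + t%:P%:P)).
  pose G : {rmorphism {poly {poly K}} -> {poly {poly K}}} :=
    comp_poly (chart_map t) \o swapXY.
  suff: F =1 G by exact.
  apply: poly2_morph_ext => [c||]; rewrite /F /G /=.
  + by rewrite subst2C !swapXY_polyC !map_polyC comp_polyC.
  + by rewrite subst2X !swapXY_X comp_polyC.
  + rewrite subst2Y swapXY_Y comp_polyX !rmorphM rmorphD /= swapXY_X swapXY_Y.
    by rewrite swapXY_polyC map_polyC /chart_map polyCM; ring.
- pose F : {rmorphism {poly {poly K}} -> {poly {poly K}}} := subst2 ('X * 'Y) 'Y.
  pose G : {rmorphism {poly {poly K}} -> {poly {poly K}}} := comp_poly (chart_map 0).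
  suff: F =1 G by exact.
  apply: poly2_morph_ext => [c||]; rewrite /F /G /=.
  + by rewrite subst2C comp_polyC.
  + by rewrite subst2X comp_polyX /chart_map !polyC0 mulr0 polyC0 addr0 mulrC.
  + by rewrite subst2Y comp_polyC.
Qed.

Lemma in_chart_exceptional d n h :
  in_chart d (exceptional d ^+ n * h) = ('X^n)%:P * in_chart d h.
Proof.
by case: d => [t|]; rewrite polyC_exp /= ?rmorphM ?rmorphXn /= ?swapXY_X.
Qed.

Lemma has_mult_uniq f m n : has_mult m f -> has_mult n f -> m = n.
Proof.
move=> [low_m [i [j [ijm fij]]]] [low_n [i' [j' [ijn fij']]]].
have [lt|lt|//] := ltngtP m n.
  by move: fij; rewrite low_n ?eqxx // ijm.
by move: fij'; rewrite low_m ?eqxx // ijn.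
Qed.

Lemma in_chart_low n d f : (forall i j, (i + j < n)%N -> f`_i`_j = 0) ->
  forall i j, (i + j < n)%N -> (in_chart d f)`_i`_j = 0.
Proof.
by move=> low i j ltn; case: d => [t|] /=; rewrite ?coef_swapXY low // addnC.
Qed.

Lemma strict_transform2 d f g : has_mult 2 f -> strict_transform f d g ->
  in_chart d f \Po chart_map (chart_slope d) = ('X^2)%:P * in_chart d g.
Proof.
move=> f2 [n [fn fE]]; rewrite -blowup_pullbackE fE -(has_mult_uniq f2 fn).
exact: in_chart_exceptional.
Qed.

(** The leading form of f at the direction d. *)
Definition direction_value f d : K :=
  let h := in_chart d f in
  h`_0`_2 + h`_1`_1 * chart_slope d + h`_2`_0 * chart_slope d ^+ 2.

(** On the exceptional divisor the strict transform is the leading form of f along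
    the chart, re-centered at the point. *)
Lemma strict_transform_coefs d f g : has_mult 2 f -> strict_transform f d g ->
  [/\ g.[0, 0] = direction_value f d,
      (in_chart d g)`_1`_0 = (in_chart d f)`_1`_1
         + (in_chart d f)`_2`_0 * chart_slope d *+ 2 &
      (in_chart d g)`_2`_0 = (in_chart d f)`_2`_0].
Proof.
move=> f2 fg; have := strict_transform2 f2 fg; have [low _] := f2.
have [h [-> h0 h1 h2]] := double_pullback (chart_slope d) (in_chart_low d low).
have X2 : ('X^2)%:P != 0 :> {poly {poly K}} by rewrite polyC_eq0 Xn_neq0.
by move=> /(mulfI X2) hE; rewrite -(in_chart_at00 d) -hE horner00 h0.
Qed.

Lemma infinitely_nearE d f : has_mult 2 f ->
  infinitely_near f d <-> direction_value f d = 0.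
Proof.
move=> f2; split=> [[g [fg g0]]|fd].
  by have [<-] := strict_transform_coefs f2 fg.
have [low _] := f2.
have [h [hE h0 h1 h2]] := double_pullback (chart_slope d) (in_chart_low d low).
exists (in_chart d h); split; last by rewrite in_chart_at00 horner00 h0.
exists 2%N; split => //; apply: (inv_inj (in_chartK d)).
by rewrite blowup_pullbackE hE in_chart_exceptional in_chartK.
Qed.

Lemma resolved_mult1 m k f : resolved m k f -> has_mult 1 f -> m = 0%N /\ k = 1%N.
Proof.
case=> // f' n s g mm kk fn n_gt1 _ _ _ _ f1.
by move: n_gt1; rewrite (has_mult_uniq fn f1).
Qed.

Lemma resolved_mult2 m k f : resolved m k f -> has_mult 2 f -> (0 < m)%N.
Proof. by case=> // f' f1 /(has_mult_uniq f1). Qed.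

End BlowUps.

Section Resolution.
Variable K : numClosedFieldType.
Implicit Types (f g h : {poly {poly K}}) (t : K) (d : option K).

(** The discriminant of the tangent cone of a double point. *)
Definition tangent_disc f : K := f`_1`_1 ^+ 2 - 4%:R * f`_2`_0 * f`_0`_2.

Lemma tangent_disc_chart d f : tangent_disc (in_chart d f) = tangent_disc f.
Proof. by case: d => //= t; rewrite /tangent_disc !coef_swapXY mulrAC. Qed.

Lemma tangent_disc_factor f d : direction_value f d = 0 ->
  ((in_chart d f)`_1`_1 + (in_chart d f)`_2`_0 * chart_slope d *+ 2) ^+ 2 =
  tangent_disc f.
Proof.
rewrite -(tangent_disc_chart d) /direction_value /tangent_disc.
set h := in_chart d f; set s := chart_slope d => h0.
have -> : h`_0`_2 = - (h`_1`_1 * s + h`_2`_0 * s ^+ 2).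
  by apply/eqP; rewrite -addr_eq0 addrA h0.
by ring.
Qed.

Lemma directions_node f : tangent_disc f != 0 ->
  exists d1 d2, d1 != d2 /\
    forall d, direction_value f d = 0 <-> d \in [:: d1; d2].
Proof.
rewrite /tangent_disc /direction_value => D0.
have [f02|f02] := eqVneq f`_0`_2 0.
  have f11 : f`_1`_1 != 0 by apply: contraNneq D0 => ->; rewrite f02 mulr0 expr0n subrr.
  exists None, (Some (- f`_2`_0 / f`_1`_1)); split=> // -[t|] /=.
    rewrite !coef_swapXY f02 mul0r addr0 !inE /= -[Some t == _]/(t == _).
    rewrite -(inj_eq (mulIf f11)) divfK // mulrC -addr_eq0 addrC.
    by split=> /eqP.
  by rewrite f02 !mulr0 expr0n mulr0 !addr0 inE eqxx.
pose D := sqrtC (f`_1`_1 ^+ 2 - 4 * f`_2`_0 * f`_0`_2).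
have DD : D ^+ 2 = f`_1`_1 ^+ 2 - 4 * f`_2`_0 * f`_0`_2 by rewrite sqrtCK.
have Dn0 : D != 0 by rewrite sqrtC_eq0.
pose t1 := (- f`_1`_1 + D) / (2 * f`_0`_2); pose t2 := (- f`_1`_1 - D) / (2 * f`_0`_2).
have two0 : (2 : K) != 0 by rewrite pnatr_eq0.
exists (Some t1), (Some t2); split.
  rewrite -[Some t1 == _]/(t1 == t2) -subr_eq0 /t1 /t2 -mulrBl mulf_eq0 invr_eq0.
  rewrite mulf_eq0 (negPf two0) (negPf f02) orbF (_ : - f`_1`_1 + D - _ = 2 * D); last by ring.
  by rewrite mulf_eq0 (negPf two0) (negPf Dn0).
case=> [t|] /=; rewrite ?coef_swapXY.
  rewrite (_ : _ + _ = f`_0`_2 * ((t - t1) * (t - t2))); last first.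
    rewrite [LHS](_ : _ = (4 * f`_0`_2)^-1 *
      ((2 * f`_0`_2 * t + f`_1`_1) ^+ 2 - D ^+ 2)).
      by rewrite /t1 /t2; field; rewrite ?f02 ?pnatr_eq0.
    by rewrite DD; field; rewrite ?f02 ?pnatr_eq0.
  rewrite !inE -[Some t == Some t1]/(t == t1) -[Some t == Some t2]/(t == t2).
  rewrite -![t == _]subr_eq0 -mulf_eq0; split=> [/eqP|/eqP->]; last by rewrite mulr0.
  by rewrite (mulf_eq0 f`_0`_2) (negPf f02).
rewrite !mulr0 expr0n mulr0 !addr0; split=> // /eqP.
by rewrite (negPf f02).
Qed.

(** A double tangent is vertical exactly when the tangent cone has no term y^2. The
    second conclusion will give the strict transform a term Y^2, where Y is the
    coordinate along the exceptional divisor. *)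
Lemma direction_cusp f : has_mult 2 f -> tangent_disc f = 0 ->
  exists d0, [/\ forall d, direction_value f d = 0 <-> d = d0,
    (in_chart d0 f)`_2`_0 != 0 &
    f`_0`_2 != 0 -> d0 != None].
Proof.
rewrite /tangent_disc /direction_value => -[_ [i [j [ij fij]]]] D0.
have two0 : (2 : K) != 0 by rewrite pnatr_eq0.
have [f02|f02] := eqVneq f`_0`_2 0.
  have f11 : f`_1`_1 = 0.
    by move/eqP: D0; rewrite f02 mulr0 subr0 expf_eq0 => /eqP.
  have f20 : f`_2`_0 != 0.
    have : (i = 0 /\ j = 2 \/ (i = 1 /\ j = 1) \/ (i = 2 /\ j = 0))%N by lia.
    by case=> [|[]] -[ei ej]; move: fij; rewrite ei ej ?f02 ?f11 ?eqxx.
  exists None; split=> //= -[t|] /=; rewrite ?coef_swapXY f02 ?f11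
    ?mul0r ?mulr0 ?expr0n ?mulr0 ?addr0 //.
  by split=> // /eqP; rewrite (negPf f20).
exists (Some (- f`_1`_1 / (2 * f`_0`_2))); split=> //=; last by rewrite coef_swapXY.
case=> [t|] /=; last first.
  by rewrite !mulr0 expr0n mulr0 !addr0; split=> // /eqP; rewrite (negPf f02).
rewrite !coef_swapXY.
have E : 4 * f`_0`_2 * (f`_2`_0 + f`_1`_1 * t + f`_0`_2 * t ^+ 2) =
   (f`_1`_1 + 2 * f`_0`_2 * t) ^+ 2.
  by rewrite -[RHS]subr0 -[X in _ = _ - X]D0; ring.
have four0 : 4 * f`_0`_2 != 0 by rewrite mulf_neq0 // pnatr_eq0.
have den0 : 2 * f`_0`_2 != 0 by rewrite mulf_neq0.
split=> [E0|[tE]].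
  congr Some; apply: (mulIf den0); rewrite divfK //.
  move/eqP: E; rewrite E0 mulr0 eq_sym expf_eq0 /= addr_eq0 => /eqP ->.
  by rewrite opprK mulrC.
by apply: (mulfI four0); rewrite E mulr0 tE mulrCA divff // mulr1 subrr expr0n.
Qed.

Lemma node_branch_smooth f g d : has_mult 2 f -> tangent_disc f != 0 ->
    direction_value f d = 0 -> strict_transform f d g -> has_mult 1 g.
Proof.
move=> f2 D0 fd fg; have [g0 g1 _] := strict_transform_coefs f2 fg.
have : (in_chart d g)`_1`_0 != 0.
  by rewrite g1 -sqrf_eq0 tangent_disc_factor.
move=> H; split=> [i j|]; last first.
  case: (d) H => [t|] /= H; last by exists 1%N, 0%N.
  by exists 0%N, 1%N; rewrite -coef_swapXY.
by rewrite ltnS leqn0 addn_eq0 => /andP[/eqP-> /eqP->]; rewrite -horner00 g0.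
Qed.

Lemma node_A_form f : (forall i j, (i + j < 2)%N -> f`_i`_j = 0) ->
  tangent_disc f != 0 -> f`_2`_0 != 0 -> exists p a b g, A_form true 1 f p a b g.
Proof.
move=> low D0 f20; have [a [b [g [fE a0 b0 g0]]]] := double_expansion low.
exists 0, a, b, g; split; rewrite ?horner0 ?g0 ?subr0 //.
by rewrite a0 b0 -subr_eq0 mulrAC.
Qed.

(** Induction on the resolution. Two distinct tangents end it after one blow-up,
    with two smooth points. With a double tangent, the strict transform g at the
    only infinitely near point is smooth, or is a double point whose tangent cone
    contains Y^2, Y being the coordinate along the exceptional divisor. The
    induction hypothesis then applies to it in the matching orientation, and
    [A_form_blowdown] transports the result to f. When the tangent is neither axis
    this yields a graph over the x-axis only; [A_form_swap] gives the graph over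
    the y-axis, which a previous blow-up in the vertical chart may require. *)
Theorem resolved_A_form m k f : resolved m k f ->
  forall s : bool, k = (if s then 2 else 1)%N -> has_mult 2 f ->
  [/\ tangent_disc f != 0 -> m = 1%N /\ s,
      f`_0`_2 != 0 -> exists p a b g, A_form s m (swapXY f) p a b g &
      f`_2`_0 != 0 -> exists p a b g, A_form s m f p a b g].
Proof.
elim=> {m k f} [f f1 s _ /(has_mult_uniq f1)//|].
move=> f n r g m k fn _ uniq_r near_r strict_r res_r IH s ks f2.
have [low _] := f2.
have near d : d \in r <-> direction_value f d = 0.
  by rewrite near_r infinitely_nearE.
have [D0|D0] := eqVneq (tangent_disc f) 0; last first.
  have [d1 [d2 [d12 dirE]]] := directions_node D0.
  have perm_r : perm_eq r [:: d1; d2].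
    apply: uniq_perm => //; first by rewrite /= inE d12.
    by move=> d; apply/idP/idP => [/near/dirE|/dirE/near].
  have mk d : d \in r -> m d = 0%N /\ k d = 1%N.
    move=> rd; apply: (resolved_mult1 (res_r d rd)).
    by apply: (node_branch_smooth f2 D0 _ (strict_r d rd)); apply/near.
  have m0 : (\sum_(d <- r) m d = 0)%N by rewrite big_seq big1 // => d /mk[].
  have k2 : (\sum_(d <- r) k d = 2)%N.
    rewrite (eq_big_seq (fun=> 1%N)) => [|d /mk[]//].
    by rewrite sum1_size (perm_size perm_r).
  have {ks} sE : s = true by move: ks; rewrite k2; case: s.
  rewrite m0 sE; split=> // f_neq0.
    apply: node_A_form; last by rewrite coef_swapXY.
      by move=> i j ij; rewrite coef_swapXY low // addnC.
    by rewrite (tangent_disc_chart (Some 0)).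
  exact: node_A_form.
have [d0 [dirE h20 d0_fin]] := direction_cusp f2 D0.
have rE : r = [:: d0].
  apply/perm_small_eq => //; apply: uniq_perm => //.
  by move=> d; rewrite inE; apply/idP/eqP => [/near/dirE|/dirE/near].
have rd0 : d0 \in r by rewrite rE mem_head.
rewrite rE !big_seq1 in ks *.
set h := in_chart d0 (g d0).
have [g0 h10 h20'] := strict_transform_coefs f2 (strict_r d0 rd0).
have fd0 : direction_value f d0 = 0 by apply/dirE.
rewrite fd0 in g0; move: (tangent_disc_factor fd0).
rewrite -h10 D0 -/h => /eqP; rewrite sqrf_eq0 => /eqP {}h10.
rewrite -/h in h20'.
have [p [a [b [h' [hA sm]]]]] : exists p a b h',
    A_form s (m d0) h p a b h' /\ (~~ s \/ (0 < m d0)%N).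
  have h00 : h`_0`_0 = 0 by rewrite -horner00 in_chart_at00.
  have [h01|h01] := eqVneq h`_0`_1 0; last first.
    have g1 : has_mult 1 (g d0).
      split=> [i j|].
        by rewrite ltnS leqn0 addn_eq0 => /andP[/eqP-> /eqP->]; rewrite -horner00.
      move: h01; rewrite /h; case: (d0) => [t|] /= h01; last by exists 0%N, 1%N.
      by exists 1%N, 0%N; rewrite -coef_swapXY.
    have [m0 k1] := resolved_mult1 (res_r _ rd0) g1.
    have sE : s = false by move: ks; rewrite k1; case: (s).
    have [||||a [b [h' hA]]] := @A_form_smooth _ h; rewrite ?h20' //.
      by move=> i j; rewrite ltnS leqn0 addn_eq0 => /andP[/eqP-> /eqP->].
    by exists 0, a, b, h'; rewrite m0 sE; split=> //; left.
  (* the coefficient of y^2 persists, so the multiplicity cannot exceed 2 *)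
  have g2 : has_mult 2 (g d0).
    have hlow i j : (i + j < 2)%N -> h`_i`_j = 0.
      case: i => [|[|i]]; case: j => [|[|j]] //=; rewrite ?addnS ?addSn //.
    split=> [i j ij|].
      by rewrite -[g d0](in_chartK d0) -/h (in_chart_low d0 hlow).
    move: h20; rewrite -h20' /h; case: (d0) => [t|] /= h20; last by exists 2%N, 0%N.
    by exists 0%N, 2%N; rewrite -coef_swapXY.
  have [_ IHy IHx] := IH d0 rd0 s ks g2.
  have m_gt0 := resolved_mult2 (res_r d0 rd0) g2.
  have [p [a [b [h' hA]]]] : exists p a b h', A_form s (m d0) h p a b h'.
    move: h20; rewrite -h20' /h; case: (d0) IHx IHy => [t|] /= IHx IHy h20; last exact: IHx.
    by apply: IHy; rewrite -coef_swapXY.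
  by exists p, a, b, h'; split=> //; right.
have [g' fA] := A_form_blowdown (strict_transform2 f2 (strict_r d0 rd0)) hA.
have p0 : p.[0] = 0 by case: hA.
split=> //.
  move: d0_fin fA; case: (d0) => [t|] /= d0_fin fA f02.
    by exists ('X * (t%:P + p)), a, b, g'.
  by have := d0_fin f02.
move: fA fd0 sm; rewrite /direction_value; case: (d0) => [t|] /= fA fd0 sm f20; last first.
  by exists ('X * (0%:P + p)), a, b, g'.
apply: (A_form_swap fA (t := t)) => //.
- by rewrite coefXM /= coefD coefC -horner0E p0 addr0.
- apply: contraNneq f20 => t0.
  by move: fd0; rewrite t0 expr0n !mulr0 !addr0 coef_swapXY => ->.
Qed.

End Resolution.

(** * Intersection numbers through local coordinates *)

Lemma clear_denominators (L : fieldType) (a b a' b' f g : L) : b != 0 -> b' != 0 ->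
  b * b' * (a / b * f + a' / b' * g) = a * b' * f + a' * b * g.
Proof. by move=> b0 b'0; field; rewrite b0 b'0. Qed.

Lemma common_denominator2 (L : fieldType) (u v b f g : L) : b != 0 ->
  u * f + v * g = b * (u / b * f + v / b * g).
Proof. by move=> b0; field. Qed.

Section LocalRing.
Variable K : fieldType.
Implicit Types (f g a b u v : {poly {poly K}}) (P : K * K).

(** A change of coordinates moving P to the origin. *)
Definition local_chart P (F : {rmorphism {poly {poly K}} -> {poly {poly K}}}) :=
  [/\ bijective F, forall c : K, F c%:P%:P = c%:P%:P &
      forall b, (F b).[0, 0] = b.[P.1, P.2]].

Variables (P : K * K) (F : {rmorphism {poly {poly K}} -> {poly {poly K}}}).
Hypothesis chartF : local_chart P F.

Let nonzero_tofrac b : b.[P.1, P.2] != 0 -> tofrac b != 0.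
Proof.
by move=> b0; rewrite tofrac_eq0; apply: contraNneq b0 => ->; rewrite !horner0.
Qed.

Lemma local_idealE f g h : local_ideal f g P (tofrac h) <->
  local_mem (F f) (F g) (F h).
Proof.
have [[G FK GK] _ evF] := chartF; split.
  move=> [_ [_ [[a [b [b0 ->]]] [a' [b' [b'0 ->]]]]]].
  have b0' := nonzero_tofrac b0; have b'0' := nonzero_tofrac b'0.
  move=> hE; have E : b * b' * h = a * b' * f + a' * b * g.
    apply/eqP; rewrite -tofrac_eq; apply/eqP.
    rewrite tofracM hE tofracM (clear_denominators _ _ _ _ b0' b'0').
    by rewrite tofracD !tofracM.
  exists (F (b * b')), (F (a * b')), (F (a' * b)).
  by rewrite evF !hornerM mulf_neq0 // -!rmorphM E !(rmorphM, rmorphD).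
move=> [b [u [v [b0]]]]; rewrite -(GK b) -(GK u) -(GK v) -!rmorphM -rmorphD.
move=> /(bij_inj (Bijective FK GK))/(congr1 (@tofrac _)).
rewrite tofracD !tofracM => E.
have b0' : (G b).[P.1, P.2] != 0 by rewrite -evF GK.
have nz := nonzero_tofrac b0'.
exists (tofrac (G u) / tofrac (G b)), (tofrac (G v) / tofrac (G b)); split.
- by exists (G u), (G b).
- by exists (G v), (G b).
by apply: (mulfI nz); rewrite E (common_denominator2 _ _ _ _ nz).
Qed.

Lemma common_denominator n (h : 'I_n -> {fraction {poly {poly K}}}) :
    (forall i, regular_at P (h i)) ->
  exists b (H : 'I_n -> {poly {poly K}}), b.[P.1, P.2] != 0 /\
    forall i, h i = tofrac (H i) / tofrac b.
Proof.
move=> /fin_all_exists[a] /fin_all_exists[b hE].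
exists (\prod_i b i), (fun i => a i * \prod_(j | j != i) b j); split.
  rewrite !horner_prod; apply/prodf_neq0 => i _; by have [] := hE i.
move=> i; have [bi0 ->] := hE i.
rewrite [\prod_(j < n) b j](bigD1 i) //=.
have c0 : (\prod_(j < n | j != i) b j).[P.1, P.2] != 0.
  by rewrite !horner_prod; apply/prodf_neq0 => j _; have [] := hE j.
have := nonzero_tofrac c0; move: (\prod_(j < n | _) _) => c {}c0.
by rewrite !tofracM -mulf_div divff // mulr1.
Qed.

(** A family of fractions can be brought to a common denominator, which is a unit
    at P; freeness is then a statement on the numerators. *)
Lemma free_codim_ge f g n :
  (exists h : 'I_n -> {fraction {poly {poly K}}},
     (forall i, regular_at P (h i)) /\ free_mod_local_ideal f g P h) <->
  codim_ge (F f) (F g) n.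
Proof.
have [[G FK GK] FC evF] := chartF; split.
  move=> [h [/common_denominator[b [H [b0 hE]]] free_h]].
  exists (fun i => F (H i)) => c mem_c; apply: free_h.
  have : local_ideal f g P (tofrac (\sum_i (c i)%:P%:P * H i)).
    rewrite local_idealE rmorph_sum /=.
    by under eq_bigr do rewrite rmorphM /= FC.
  move=> [u [v [[a1 [b1 [b10 uE]]] [a2 [b2 [b20 vE]]] E]]].
  exists (u / tofrac b), (v / tofrac b); split.
  - exists a1, (b1 * b); rewrite !hornerM mulf_neq0 //; split=> //.
    by rewrite uE rmorphM invfM mulrA.
  - exists a2, (b2 * b); rewrite !hornerM mulf_neq0 //; split=> //.
    by rewrite vE rmorphM invfM mulrA.
  rewrite -2!(mulrAC _ _ (tofrac b)^-1) -mulrDl -E rmorph_sum mulr_suml.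
  by apply: eq_bigr => i _; rewrite hE rmorphM /= mulrA.
move=> [H free_H]; exists (fun i => tofrac (G (H i))); split.
  move=> i; exists (G (H i)), 1; rewrite tofrac1 divr1; split=> //.
  by rewrite -[1]polyC1 hornerC -[1]polyC1 hornerC oner_eq0.
move=> c; under eq_bigr do rewrite -rmorphM /=.
rewrite -rmorph_sum local_idealE rmorph_sum /= => mem_c; apply: free_H.
by under eq_bigr do [rewrite -(GK (H _)) -FC -rmorphM].
Qed.

End LocalRing.

Section IntersectionNumber.
Variables (R : realType).
Let K : fieldType := R[i].
Variables (P : K * K) (F : {rmorphism {poly {poly K}} -> {poly {poly K}}}).
Hypothesis chartF : local_chart P F.
Implicit Types (f g : {poly {poly R[i]}}).

Lemma imult_ge f g n :
  ((n%:R)%:E <= imult f g P)%E <-> codim_ge (F f) (F g) n.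
Proof.
split=> [le_n|ge_n]; last first.
  by apply: ereal_sup_ubound; exists n => //=; apply/(free_codim_ge chartF).
case: n le_n => [|n] le_n; first exact: codim_ge0.
apply: contrapT => lt_n; move: le_n; apply/negP; rewrite -ltNge.
apply: (@le_lt_trans _ _ (n%:R)%:E); last by rewrite lte_fin ltr_nat.
apply: ub_ereal_sup => _ [m /= /(free_codim_ge chartF) ge_m <-].
rewrite lee_fin ler_nat leqNgt; apply/negP => lt_nm; apply: lt_n.
exact: codim_ge_le ge_m.
Qed.

Lemma imult_eq f g n : imult f g P = (n%:R)%:E <->
  codim_ge (F f) (F g) n /\ ~ codim_ge (F f) (F g) n.+1.
Proof.
rewrite -2!imult_ge; split=> [->|[le_n lt_n]].
  by split=> //; rewrite lee_fin ler_nat ltnn.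
apply/eqP; rewrite eq_le le_n andbT leNgt; apply/negP => lt.
apply: lt_n; move: lt; rewrite /imult => /ereal_sup_gt[_ [m /= Am <-]].
rewrite lte_fin ltr_nat => lt_nm.
rewrite imult_ge; apply: (@codim_ge_le _ _ _ _ m) => //.
exact/(free_codim_ge chartF).
Qed.

End IntersectionNumber.

(** * Convergence of the graph of a smooth curve *)

Section L1Norm.
Variable K : numFieldType.
Implicit Types (p q u v : {poly K}) (f g : {poly {poly K}}) (e : K).

(** The norm sum |p_i| e^i is submultiplicative and bounds both p on the disc of
    radius e and the partial sums of its coefficients. No Cauchy estimate is then
    needed to pass from the size of the iterates to the size of their coefficients. *)
Definition abs_poly p := \poly_(i < size p) `|p`_i|.
Definition l1norm e p := (abs_poly p).[e].

Lemma coef_abs_poly p i : (abs_poly p)`_i = `|p`_i|.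
Proof.
by rewrite coef_poly; case: ltnP => // le_pi; rewrite nth_default ?normr0.
Qed.

Lemma l1norm_wide n e p : (size p <= n)%N ->
  l1norm e p = \sum_(i < n) `|p`_i| * e ^+ i.
Proof.
move=> le_pn; rewrite /l1norm (horner_coef_wide _ (leq_trans (size_poly _ _) le_pn)).
by apply: eq_bigr => i _; rewrite coef_abs_poly.
Qed.

Lemma l1normC e c : l1norm e c%:P = `|c|.
Proof.
rewrite /l1norm [abs_poly _](_ : _ = `|c|%:P) ?hornerC //.
by apply/polyP => i; rewrite coef_abs_poly !coefC; case: ifP; rewrite ?normr0.
Qed.

Lemma l1normN e p : l1norm e (- p) = l1norm e p.
Proof.
rewrite /l1norm; congr _.[_]; apply/polyP => i.
by rewrite !coef_abs_poly coefN normrN.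
Qed.

Lemma l1normMX e p : l1norm e (p * 'X) = l1norm e p * e.
Proof.
rewrite /l1norm -hornerMX; congr _.[_]; apply/polyP => i.
by rewrite coefMX !coef_abs_poly coefMX; case: ifP; rewrite ?normr0.
Qed.

Lemma l1normXM e p : l1norm e ('X * p) = e * l1norm e p.
Proof. by rewrite mulrC l1normMX mulrC. Qed.

Variable e : K.
Hypothesis e_ge0 : 0 <= e.

Lemma l1norm_ge0 p : 0 <= l1norm e p.
Proof.
rewrite (l1norm_wide _ (leqnn _)); apply: sumr_ge0 => i _.
by rewrite mulr_ge0 // exprn_ge0.
Qed.

Lemma l1normD p q : l1norm e (p + q) <= l1norm e p + l1norm e q.
Proof.
pose n := maxn (size p) (size q).
rewrite (@l1norm_wide n _ p) ?leq_maxl // (@l1norm_wide n _ q) ?leq_maxr //.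
rewrite (@l1norm_wide n) ?(leq_trans (size_polyD _ _)) // -big_split.
apply: ler_sum => i _ /=; rewrite -mulrDl ler_wpM2r ?exprn_ge0 // coefD.
exact: ler_normD.
Qed.

Lemma l1normM p q : l1norm e (p * q) <= l1norm e p * l1norm e q.
Proof.
have scale c : l1norm e (c%:P * q) = `|c| * l1norm e q.
  rewrite (@l1norm_wide (size q)) ?(leq_trans (size_polyMleq _ _)) //; last first.
    by rewrite size_polyC; case: (c != 0); rewrite //= add0n leq_pred.
  rewrite (l1norm_wide _ (leqnn _)) mulr_sumr; apply: eq_bigr => i _.
  by rewrite coefCM normrM mulrA.
elim/poly_ind: p => [|p c IHp]; first by rewrite mul0r -polyC0 l1normC normr0 mul0r.
have -> : l1norm e (p * 'X + c%:P) = l1norm e p * e + `|c|.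
  rewrite /l1norm -hornerMX -[`|c|](hornerC _ e) -hornerD; congr _.[_].
  apply/polyP => i; rewrite coefD coefMX !coef_abs_poly coefD coefMX !coefC.
  by case: i => [|i] /=; rewrite ?add0r ?addr0.
rewrite !mulrDl -scale -mulrA [_ * q]mulrC mulrA.
apply: le_trans (l1normD _ _) _; rewrite lerD2r l1normMX.
by rewrite mulrAC ler_wpM2r.
Qed.

Lemma partial_l1norm n p : \sum_(i < n) `|p`_i| * e ^+ i <= l1norm e p.
Proof.
pose m := (maxn n (size p)).
rewrite (@l1norm_wide m) ?leq_maxr //.
rewrite (big_ord_widen m (fun i => `|p`_i| * e ^+ i)) ?leq_maxl //.
rewrite big_mkcond; apply: ler_sum => i _; case: ifP => // _.
by rewrite mulr_ge0 // exprn_ge0.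
Qed.

Lemma partial_horner_le n p x : `|x| <= e ->
  `|\sum_(i < n) p`_i * x ^+ i| <= l1norm e p.
Proof.
move=> xe; apply: le_trans (partial_l1norm n p).
apply: le_trans (ler_norm_sum _ _ _) _; apply: ler_sum => i _.
by rewrite normrM normrX ler_wpM2l // lerXn2r // nnegrE.
Qed.

Lemma horner_le_l1norm p x : `|x| <= e -> `|p.[x]| <= l1norm e p.
Proof. by move=> xe; rewrite horner_coef partial_horner_le. Qed.

Lemma l1norm_le1 p : e <= 1 -> l1norm e p <= l1norm 1 p.
Proof.
move=> e1; rewrite !(l1norm_wide _ (leqnn _)); apply: ler_sum => i _.
by rewrite expr1n mulr1 ler_piMr // exprn_ile1.
Qed.

End L1Norm.

Section Contraction.
Variable K : numFieldType.
Implicit Types (p q u v : {poly K}) (f g : {poly {poly K}}) (e M eta : K).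

Lemma l1norm_lipschitz f : exists2 M, 0 <= M & forall e u v, 0 <= e <= 1 ->
    l1norm e u <= 1 -> l1norm e v <= 1 ->
  l1norm e f.[u] <= M /\
  l1norm e (f.[u] - f.[v]) <= M * l1norm e (u - v).
Proof.
elim/poly_ind: f => [|f c [M M0 IHf]].
  exists 0 => // e u v _ _ _.
  by rewrite !horner0 subrr -polyC0 l1normC normr0 mul0r.
have c0 : 0 <= l1norm 1 c by rewrite l1norm_ge0.
exists (M *+ 2 + l1norm 1 c) => [|e u v /andP[e0 e1] u1 v1].
  by rewrite addr_ge0 ?mulrn_wge0.
have [|Mu dM] := IHf e u v _ u1 v1; first by rewrite e0.
rewrite !hornerMXaddC; split.
  apply: le_trans (l1normD e0 _ _) _; rewrite lerD //; last by rewrite l1norm_le1.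
  apply: le_trans (l1normM e0 _ _) _; rewrite mulr2n.
  apply: (@le_trans _ _ M); last by rewrite lerDl.
  by rewrite -[leRHS]mulr1 ler_pM ?l1norm_ge0.
have [|Mv _] := IHf e v v _ v1 v1; first by rewrite e0.
have -> : f.[u] * u + c - (f.[v] * v + c) = (f.[u] - f.[v]) * u + f.[v] * (u - v).
  by ring.
apply: le_trans (l1normD e0 _ _) _; rewrite [X in _ <= X]mulrDl.
apply: (@le_trans _ _ (M *+ 2 * l1norm e (u - v))); last first.
  by rewrite lerDl mulr_ge0 ?l1norm_ge0.
rewrite mulr2n [X in _ <= X]mulrDl lerD //.
  apply: le_trans (l1normM e0 _ _) _; apply: (@le_trans _ _ (l1norm e (f.[u] - f.[v]))) => //.
  by rewrite ler_piMr ?l1norm_ge0.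
by apply: le_trans (l1normM e0 _ _) _; rewrite ler_wpM2r ?l1norm_ge0.
Qed.

(** Such a g has the form x a + x b y + y^2 h, so its Lipschitz constant on the ball
    of radius eta is at most e M + 3 eta M, where M bounds a, b and h. *)
Lemma contraction_radius g : g.[0, 0] = 0 -> g^`().[0, 0] = 0 ->
  exists e eta, [/\ 0 < e, 0 < eta, l1norm e g.[0] <= eta / 2%:R &
    forall u v, l1norm e u <= eta -> l1norm e v <= eta ->
      l1norm e (g.[u] - g.[v]) <= l1norm e (u - v) / 2%:R].
Proof.
move=> g0 g'0; have [h gE] := poly_taylor2 g 0.
have [a aE] := root0_factor g0; have [b bE] := root0_factor g'0.
rewrite !polyC0 in aE bE; rewrite aE bE polyC0 subr0 in gE.
have [M0 M0_ge0 lipM0] := l1norm_lipschitz h.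
pose M := 1 + (l1norm 1 a + l1norm 1 b + M0).
have a_ge0 : 0 <= l1norm 1 a by rewrite l1norm_ge0.
have b_ge0 : 0 <= l1norm 1 b by rewrite l1norm_ge0.
have M_ge1 : 1 <= M by rewrite /M lerDl !addr_ge0.
have M_gt0 : 0 < M by apply: lt_le_trans M_ge1.
have aM : l1norm 1 a <= M by rewrite /M addrCA -addrA lerDl !addr_ge0.
have bM : l1norm 1 b <= M.
  by rewrite /M addrAC addrA lerDr !addr_ge0.
have M0M : M0 <= M by rewrite /M addrA lerDr !addr_ge0.
(* 3 eta M = 1/4 and e M = eta / 2 <= 1/4, so the Lipschitz constant is 1/2 *)
pose eta := (12%:R * M)^-1; pose e := eta / (2%:R * M).
have eta_gt0 : 0 < eta by rewrite invr_gt0 mulr_gt0 // ltr0n.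
have e_gt0 : 0 < e by rewrite divr_gt0 // mulr_gt0 // ltr0n.
have eta_le1 : eta <= 1.
  rewrite invf_le1 ?mulr_gt0 ?ltr0n //; apply: le_trans M_ge1 _.
  by rewrite ler_peMl ?ler1n // ltW.
have eM : e * M = eta / 2%:R by rewrite /e; field; rewrite gt_eqF.
have e_le1 : e <= 1.
  apply: le_trans eta_le1; rewrite ler_pdivrMr ?mulr_gt0 ?ltr0n //.
  apply: ler_peMr; first exact: ltW.
  by apply: le_trans M_ge1 _; apply: ler_peMl; [exact: ltW|rewrite ler1n].
have e01 : 0 <= e <= 1 by rewrite ltW.
have e_ge0 := ltW e_gt0.
exists e, eta; split=> // [|u v u_le v_le].
  rewrite aE l1normXM -eM ler_wpM2l // (le_trans _ aM) // l1norm_le1 //.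
have u1 := le_trans u_le eta_le1; have v1 := le_trans v_le eta_le1.
have [hu hd] := lipM0 e u v e01 u1 v1.
have -> : g.[u] - g.[v] =
    (u - v) * ('X * b + (u + v) * h.[u]) + v * v * (h.[u] - h.[v]).
  rewrite gE !(hornerD, hornerM, hornerC, hornerX, horner_exp); ring.
set d := l1norm e (u - v); have d_ge0 : 0 <= d by rewrite l1norm_ge0.
have uv : l1norm e (u + v) <= eta + eta by apply: le_trans (l1normD _ _ _) _; rewrite ?lerD.
have N1 : l1norm e ('X * b + (u + v) * h.[u]) <= e * M + (eta + eta) * M.
  apply: le_trans (l1normD e_ge0 _ _) _; apply: lerD.
    by rewrite l1normXM ler_wpM2l // (le_trans _ bM) // l1norm_le1.
  apply: le_trans (l1normM e_ge0 _ _) _; apply: ler_pM; rewrite ?l1norm_ge0 //.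
  exact: le_trans hu M0M.
have N2 : l1norm e (v * v * (h.[u] - h.[v])) <= eta * M * d.
  apply: le_trans (l1normM e_ge0 _ _) _; rewrite -mulrA; apply: ler_pM; rewrite ?l1norm_ge0 //.
    apply: le_trans (l1normM e_ge0 _ _) _; rewrite -[leRHS]mulr1.
    by apply: ler_pM; rewrite ?l1norm_ge0.
  by apply: le_trans hd _; rewrite ler_wpM2r.
apply: le_trans (l1normD e_ge0 _ _) _.
apply: (@le_trans _ _ (d * (e * M + (eta + eta) * M) + eta * M * d)).
  apply: lerD => //; apply: le_trans (l1normM e_ge0 _ _) _.
  by rewrite ler_wpM2l.
have -> : d * (e * M + (eta + eta) * M) + eta * M * d = d * (eta / 2%:R + 3%:R * (eta * M)).
  by rewrite eM; ring.
rewrite ler_wpM2l // (_ : eta * M = 12%:R^-1); last first.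
  by rewrite /eta; field; rewrite gt_eqF.
rewrite [X in _ <= X](_ : _ = 4%:R^-1 + 3%:R * 12%:R^-1); last by field.
rewrite lerD2r; apply: (@le_trans _ _ (12%:R^-1 / 2%:R)).
  apply: ler_wpM2r; first by rewrite invr_ge0 ler0n.
  rewrite /eta lef_pV2 ?posrE ?mulr_gt0 ?ltr0n //.
  by rewrite ler_peMr ?ler0n.
by rewrite -invfM -natrM lef_pV2 ?posrE ?ltr0n // ler_nat.
Qed.

End Contraction.

Lemma pseries_lim (K : numFieldType) (c : nat -> K) (x L : K) :
    (forall eps : K, 0 < eps -> exists N, forall n, (N <= n)%N ->
      `|L - \sum_(i < n) c i * x ^+ i| < eps) ->
  cvgn (Defs.pseries c x) /\ limn (Defs.pseries c x) = L.
Proof.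
move=> lim_L; have cvgL : (Defs.pseries c x @ \oo --> L)%classic.
  apply/cvgrPdist_lt => eps /lim_L[N leN]; exists N => // n /= le_Nn.
  by rewrite /Defs.pseries /series /= big_mkord; apply: leN.
by split; [apply/cvg_ex; exists L|exact: cvg_lim cvgL].
Qed.

Section ComplexSeries.
Variable R : realType.
Implicit Types (z : nat -> R[i]) (u : nat -> R).

Lemma real_series_abs_cvg u B : (forall n, \sum_(i < n) `|u i| <= B) ->
  exists l, forall eps, 0 < eps -> exists N, forall n, (N <= n)%N ->
    `|l - \sum_(i < n) u i| < eps.
Proof.
move=> leB.
have cvg_norm : cvgn (series (fun i => `|u i|)).
  apply: nondecreasing_is_cvgn.
    apply/nondecreasing_seqP => n.
    by rewrite seriesEord /= big_ord_recr lerDl normr_ge0.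
  by exists B => _ [n _ <-]; rewrite seriesEord /=; exact: leB.
have /cvg_ex[/= l /cvgrPdist_lt lim_l] := @normed_cvg R R^o u cvg_norm.
exists l => eps /lim_l[N _ leN]; exists N => n le_Nn.
rewrite (_ : \sum_(i < n) u i = series (u : nat -> R^o) n); first exact: leN.
by rewrite /series /= big_mkord.
Qed.

Lemma Re_norm_le (w : R[i]) : `|complex.Re w| <= complex.Re `|w|.
Proof. by have := normc_ge_Re w; rewrite lecE => /andP[]. Qed.

Lemma Im_norm_le (w : R[i]) : `|complex.Im w| <= complex.Re `|w|.
Proof.
rewrite normc_def /= -sqrtr_sqr ler_wsqrtr // lerDr; exact: sqr_ge0.
Qed.

Lemma norm_le_ReIm (w : R[i]) : `|w| <= (`|complex.Re w| + `|complex.Im w|)%:C%C.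
Proof.
rewrite normc_def lecR -[leRHS]ger0_norm ?addr_ge0 // -sqrtr_sqr ler_wsqrtr //.
rewrite sqrrD !real_normK ?num_real // -addrA lerD2l addrC lerDl.
by rewrite mulrn_wge0 // mulr_ge0.
Qed.

Lemma complex_Re_sum z n : complex.Re (\sum_(i < n) z i) = \sum_(i < n) complex.Re (z i).
Proof. by apply: (big_morph (@complex.Re R)) => // -[a b] [c d]. Qed.

Lemma complex_Im_sum z n : complex.Im (\sum_(i < n) z i) = \sum_(i < n) complex.Im (z i).
Proof. by apply: (big_morph (@complex.Im R)) => // -[a b] [c d]. Qed.

(** Absolutely convergent series of complex numbers converge, through their real
    and imaginary parts. *)
Lemma complex_series_abs_cvg z B : (forall n, \sum_(i < n) `|z i| <= B) ->
  exists L, forall eps, 0 < eps -> exists N, forall n, (N <= n)%N ->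
    `|L - \sum_(i < n) z i| < eps.
Proof.
move=> leB; have leReB n : \sum_(i < n) complex.Re `|z i| <= complex.Re B.
  by have := leB n; rewrite lecE -(complex_Re_sum (fun i => `|z i|)) => /andP[].
have [|a lima] := @real_series_abs_cvg (fun i => complex.Re (z i)) (complex.Re B).
  by move=> n; apply: le_trans (leReB n); apply: ler_sum => i _; exact: Re_norm_le.
have [|b limb] := @real_series_abs_cvg (fun i => complex.Im (z i)) (complex.Re B).
  by move=> n; apply: le_trans (leReB n); apply: ler_sum => i _; exact: Im_norm_le.
exists (Complex a b) => eps; rewrite ltcE /= => /andP[/eqP Im_eps eps_gt0].
have eps2 : 0 < complex.Re eps / 2 by rewrite divr_gt0.
have [N leN] := lima _ eps2; have [M leM] := limb _ eps2.
exists (maxn N M) => n; rewrite geq_max => /andP[/leN ltRe /leM ltIm].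
apply: le_lt_trans (norm_le_ReIm _) _.
rewrite ltcE /= Im_eps eqxx /=.
have -> : complex.Re (Complex a b - \sum_(i < n) z i) = a - \sum_(i < n) complex.Re (z i).
  by rewrite -complex_Re_sum; case: (\sum_(i < n) z i).
have -> : complex.Im (Complex a b - \sum_(i < n) z i) = b - \sum_(i < n) complex.Im (z i).
  by rewrite -complex_Im_sum; case: (\sum_(i < n) z i).
by rewrite [ltRHS]splitr ltrD.
Qed.

(** The field R[i] is archimedean for the absolute value. *)
Lemma geometric_bound_eq0 (w b : R[i]) : 0 <= b ->
  (forall n, `|w| <= b / 2 ^+ n) -> w = 0.
Proof.
move=> b_ge0 le_w; apply/eqP; rewrite -normr_eq0; apply/eqP.
have bE : b = (complex.Re b)%:C%C by rewrite RRe_real // ger0_real.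
have wE : `|w| = (complex.Re `|w|)%:C%C by rewrite RRe_real // ger0_real.
rewrite wE; suff -> : complex.Re `|w| = 0 by [].
apply/eqP; rewrite eq_le -!lecR -wE normr_ge0 andbT wE lecR leNgt.
apply/negP => w_gt0.
have [n] : exists n : nat, complex.Re b / complex.Re `|w| < n%:R.
  by exists (Num.trunc (complex.Re b / complex.Re `|w|)).+1; rewrite truncnS_gt.
rewrite ltr_pdivrMr // => lt_b.
have := le_w n; rewrite ler_pdivlMr ?exprn_gt0 ?ltr0n // bE wE.
rewrite -natrX -(rmorph_nat (real_complex R)) -rmorphM lecR leNgt => /negP; apply.
apply: lt_le_trans lt_b _; rewrite mulrC ler_wpM2l ?(ltW w_gt0) // ler_nat.
exact/ltnW/ltn_expl.
Qed.

End ComplexSeries.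

Section AnalyticGraph.
Variable K : numFieldType.
Hypothesis abs_complete : forall (z : nat -> K) (B : K),
    (forall n, \sum_(i < n) `|z i| <= B) ->
  exists L, forall eps : K, 0 < eps -> exists N, forall n, (N <= n)%N ->
    `|L - \sum_(i < n) z i| < eps.
Hypothesis archimedean : forall w b : K, 0 <= b ->
  (forall n, `|w| <= b / 2 ^+ n) -> w = 0.
Implicit Types (g : {poly {poly K}}) (p u v : {poly K}) (x y L e eta : K).

Lemma picard_coef_stable g n m : g.[0, 0] = 0 -> g^`().[0, 0] != 0 ->
  (n <= m)%N -> forall i, (i <= n)%N -> (picard g m)`_i = (picard g n)`_i.
Proof.
move=> g0 g'0 le_nm i le_in; elim: m le_nm => [|m IHm].
  by rewrite leqn0 => /eqP->.
rewrite leq_eqVlt => /orP[/eqP->//|]; rewrite ltnS => le_nm.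
rewrite -IHm //= coefB coefCM; have [_ /dvdXnP gm] := picard_graph m g0 g'0.
by rewrite gm ?mulr0 ?subr0 // ltnS (leq_trans le_in).
Qed.

(** The iterates y_n stay in the ball of radius eta and their differences shrink by
    1/2, so the coefficients of the limit series are absolutely summable on the
    disc of radius e. Its n-th partial sums are those of y_n, whence its sum L
    differs from y_n(x) by at most eta / 2^n and is a fixed point of the
    contraction, that is a zero of g(x, -). Contraction also gives the uniqueness of
    the zero. *)
Theorem implicit_function_series g : g.[0, 0] = 0 -> g^`().[0, 0] != 0 ->
  local_analytic_equation (swapXY g) (fun i => (picard g i)`_i : K).
Proof.
move=> g0 g'0; set d := fun i : nat => _.
pose c := (g^`().[0, 0])^-1; pose Q := 'X - c%:P%:P * g.
have QE u : Q.[u] = u - c%:P * g.[u].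
  by rewrite !(hornerD, hornerN, hornerM, hornerX, hornerC).
have Q0 : Q.[0, 0] = 0.
  by rewrite QE !(hornerD, hornerN, hornerM, hornerC) g0 mulr0 subrr.
have Q'0 : Q^`().[0, 0] = 0.
  rewrite /Q !poly.derivE !(hornerD, hornerN, hornerM, hornerC).
  by rewrite /c mulVf // subrr.
have [e [eta [e_gt0 eta_gt0 Q_small Q_contr]]] := contraction_radius Q0 Q'0.
have e_ge0 := ltW e_gt0; have eta_ge0 := ltW eta_gt0.
pose y := picard g.
have yS n : y n.+1 = Q.[y n] by rewrite QE.
have N0 : l1norm e 0 <= eta by rewrite -polyC0 l1normC normr0.
have y_le n : l1norm e (y n) <= eta.
  elim: n => [//|n IHn]; rewrite yS -[Q.[y n]](subrK Q.[0]).
  apply: le_trans (l1normD e_ge0 _ _) _; rewrite [leRHS]splitr lerD //.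
  apply: le_trans (Q_contr _ _ IHn N0) _; rewrite subr0.
  by rewrite ler_wpM2r // invr_ge0 ler0n.
have y_cauchy n k : l1norm e (y (n + k)%N - y n) <= eta / 2 ^+ n.
  elim: n => [|n IHn]; first by rewrite subr0 expr0 divr1.
  rewrite addSn !yS; apply: le_trans (Q_contr _ _ (y_le _) (y_le _)) _.
  by rewrite exprSr invfM mulrA ler_wpM2r // invr_ge0 ler0n.
have dE k i : (i <= k)%N -> (y k)`_i = d i.
  by move=> le_ik; apply: (picard_coef_stable g0 g'0 le_ik).
pose s x k := \sum_(i < k) d i * x ^+ i.
have sE x k : s x k = \sum_(i < k) (y k)`_i * x ^+ i.
  by apply: eq_bigr => i _; rewrite dE // ltnW.
have s_close x n : `|x| <= e -> exists N, forall k, (N <= k)%N ->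
    `|s x k - (y n).[x]| <= eta / 2 ^+ n.
  move=> xe; exists (maxn n (size (y n))) => k; rewrite geq_max => /andP[le_nk le_sk].
  rewrite sE (horner_coef_wide _ le_sk) -sumrB.
  rewrite (eq_bigr (fun i : 'I_k => (y k - y n)`_i * x ^+ i)); last first.
    by move=> i _; rewrite coefB mulrBl.
  apply: le_trans (partial_horner_le e_ge0 _ _ xe) _.
  by rewrite -(subnKC le_nk) y_cauchy.
have limit x : `|x| <= e -> exists L, (forall eps, 0 < eps -> exists N, forall n,
    (N <= n)%N -> `|L - s x n| < eps).
  move=> xe; apply: (@abs_complete (fun i => d i * x ^+ i) eta) => n.
  apply: le_trans (y_le n); apply: le_trans (partial_l1norm e_ge0 n _).
  apply: ler_sum => i _; rewrite normrM normrX dE 1?ltnW // ler_wpM2l //.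
  by rewrite lerXn2r // nnegrE.
have limit_close x L n : `|x| <= e -> (forall eps, 0 < eps -> exists N, forall n,
    (N <= n)%N -> `|L - s x n| < eps) -> `|L - (y n).[x]| <= eta / 2 ^+ n.
  move=> xe limL; apply/ler_addgt0Pr => eps /limL[N leN].
  have [N' leN'] := s_close x n xe.
  pose k := maxn N N'.
  have -> : L - (y n).[x] = (s x k - (y n).[x]) + (L - s x k) by ring.
  apply: le_trans (ler_normD _ _) _; rewrite lerD //.
    by apply: leN'; rewrite leq_maxr.
  by apply/ltW/leN; rewrite leq_maxl.
have Q_point x a b : `|x| <= e -> `|a| <= eta -> `|b| <= eta ->
    `|Q.[a, x] - Q.[b, x]| <= `|a - b| / 2.
  move=> xe ae be; rewrite -hornerN -hornerD.
  apply: le_trans (horner_le_l1norm e_ge0 _ xe) _.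
  apply: le_trans (Q_contr _ _ _ _) _; rewrite ?l1normC //.
  by rewrite -polyCN -polyCD l1normC.
have Q_fixed x L : `|x| <= e -> (forall eps, 0 < eps -> exists N, forall n,
    (N <= n)%N -> `|L - s x n| < eps) -> `|L| <= eta /\ Q.[L, x] = L.
  move=> xe limL; have close n := limit_close x L n xe limL.
  have L_le : `|L| <= eta.
    by have := close 0%N; rewrite expr0 divr1 horner0 subr0.
  split=> //; apply/eqP; rewrite -subr_eq0; apply/eqP.
  apply: (@archimedean _ (eta + eta)); first by rewrite addr_ge0.
  move=> n; have -> : Q.[L, x] - L = (Q.[L, x] - (y n.+1).[x]) + ((y n.+1).[x] - L) by ring.
  apply: le_trans (ler_normD _ _) _.
  rewrite mulrDl lerD //; last first.
    rewrite distrC; apply: le_trans (close n.+1) _.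
    by rewrite exprSr invfM mulrA ler_piMr ?divr_ge0 ?exprn_ge0 // invf_le1 ?ler1n ?ltr0n.
  have yx_le : `|(y n).[x]| <= eta.
    exact: le_trans (horner_le_l1norm e_ge0 _ xe) (y_le n).
  rewrite yS (horner_horner Q (y n)); apply: le_trans (Q_point _ _ _ xe L_le yx_le) _.
  by apply: le_trans _ (close n); rewrite ler_piMr // invf_le1 ?ler1n ?ltr0n.
have Q_root x a : (g.[a, x] = 0) <-> (Q.[a, x] = a).
  rewrite QE !(hornerD, hornerN, hornerM, hornerC); split=> [->|/eqP].
    by rewrite mulr0 subr0.
  rewrite -subr_eq0 addrAC subrr add0r oppr_eq0 mulf_eq0 invr_eq0.
  by rewrite (negPf g'0) => /eqP.
exists (e * eta / (e + eta)); split.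
  by rewrite divr_gt0 ?mulr_gt0 ?addr_gt0.
have rad_e : e * eta / (e + eta) <= e.
  by rewrite ler_pdivrMr ?addr_gt0 // ler_wpM2l // lerDr.
have rad_eta : e * eta / (e + eta) <= eta.
  by rewrite ler_pdivrMr ?addr_gt0 // mulrC ler_wpM2l // lerDl.
move=> x x_lt; have xe : `|x| <= e by apply: le_trans (ltW x_lt) rad_e.
have [L limL] := limit x xe; have [cvgL LE] := pseries_lim limL.
have [L_le QL] := Q_fixed x L xe limL.
split=> // a a_lt; rewrite LE horner2_swapXY Q_root.
split=> [Qa|->//]; have a_le : `|a| <= eta by apply: le_trans (ltW a_lt) rad_eta.
apply/eqP; rewrite -subr_eq0 -normr_le0; have := Q_point x a L xe a_le L_le.
by rewrite Qa QL {1}(splitr `|a - L|) gerDl pmulr_lle0 // invr_gt0 ltr0n.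
Qed.

End AnalyticGraph.

Theorem analytic_graph (R : realType) (g : {poly {poly R[i]}}) :
    g.[0, 0] = 0 -> g^`().[0, 0] != 0 ->
  local_analytic_equation (swapXY g) (fun i => (picard g i)`_i).
Proof.
apply: implicit_function_series; last exact: geometric_bound_eq0.
exact: complex_series_abs_cvg.
Qed.

(** * Local coordinates adapted to a double point *)

Section Charts.
Variable K : fieldType.
Implicit Types (f g u v A B D : {poly {poly K}}) (P : K * K) (c : K).

Lemma subst2_horner u v f x y : (subst2 u v f).[x, y] = f.[u.[x, y], v.[x, y]].
Proof.
pose F : {rmorphism {poly {poly K}} -> K} :=
  horner_eval y \o horner_eval x%:P \o subst2 u v.
pose G : {rmorphism {poly {poly K}} -> K} :=
  horner_eval v.[x, y] \o horner_eval (u.[x, y])%:P.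
suff: F =1 G by exact.
apply: poly2_morph_ext => [c||]; rewrite /F /G /= /horner_eval.
- by rewrite subst2C !hornerC.
- by rewrite subst2X hornerX hornerC.
- by rewrite subst2Y hornerC hornerX.
Qed.

Lemma subst2_cancel u v u' v' : subst2 u' v' u = 'X -> subst2 u' v' v = 'Y ->
  cancel (subst2 u v) (subst2 u' v').
Proof.
move=> uX vY f.
pose F : {rmorphism {poly {poly K}} -> {poly {poly K}}} := subst2 u' v' \o subst2 u v.
pose G : {rmorphism {poly {poly K}} -> {poly {poly K}}} := idfun.
suff: F =1 G by exact.
apply: poly2_morph_ext => [c||]; rewrite /F /G /=.
- by rewrite !subst2C.
- by rewrite subst2X.
- by rewrite subst2Y.
Qed.

Lemma local_chart_comp P (F L : {rmorphism {poly {poly K}} -> {poly {poly K}}}) :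
  local_chart P F -> local_chart (0, 0) L -> local_chart P (L \o F).
Proof.
case=> bijF FC evF [bijL LC evL]; split=> [|c|b] /=.
- exact: bij_comp.
- by rewrite FC LC.
- by rewrite evL evF.
Qed.

Lemma local_chart_swap : local_chart (0, 0) (swapXY : {poly {poly K}} -> _).
Proof.
split=> [|c|b]; first exact: (Bijective (@swapXYK K) (@swapXYK K)).
  by rewrite /= swapXY_polyC map_polyC.
by rewrite /= horner2_swapXY.
Qed.

(** Only needed for a node whose branches are tangent to the two axes. *)
Lemma local_chart_shear : local_chart (0, 0) (subst2 'X ('X + 'Y) : {poly {poly K}} -> _).
Proof.
split=> [|c|b]; last 2 first.
- by rewrite /= subst2C.
- by rewrite /= subst2_horner !(hornerD, hornerX, hornerC) addr0.
exists (subst2 'X ('Y - 'X)); apply: subst2_cancel.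
- by rewrite subst2X.
- by rewrite rmorphD /= subst2X subst2Y subrKC.
- by rewrite subst2X.
- by rewrite subst2_is_zmod_morphism subst2X subst2Y addrAC subrr add0r.
Qed.

Lemma local_chart_centered P :
  local_chart P (subst2 ('X + P.1%:P%:P) ('Y + P.2%:P%:P) : {poly {poly K}} -> _).
Proof.
split=> [|c|b]; last 2 first.
- by rewrite /= subst2C.
- by rewrite /= subst2_horner !(hornerD, hornerX, hornerC) !add0r.
exists (subst2 ('X + (- P.1)%:P%:P) ('Y + (- P.2)%:P%:P)); apply: subst2_cancel.
- by rewrite rmorphD /= subst2X subst2C -addrA -!polyCD addNr !polyC0 addr0.
- by rewrite rmorphD /= subst2Y subst2C -addrA -!polyCD addNr !polyC0 addr0.
- by rewrite rmorphD /= subst2X subst2C -addrA -!polyCD addrN !polyC0 addr0.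
- by rewrite rmorphD /= subst2Y subst2C -addrA -!polyCD addrN !polyC0 addr0.
Qed.

Lemma centered0 f : centered f (0, 0) = f.
Proof.
pose F : {rmorphism {poly {poly K}} -> {poly {poly K}}} :=
  subst2 ('X + 0%:P%:P) ('Y + 0%:P%:P).
pose G : {rmorphism {poly {poly K}} -> {poly {poly K}}} := idfun.
suff: F =1 G by exact.
apply: poly2_morph_ext => [c||]; rewrite /F /G /=.
- by rewrite /= subst2C.
- by rewrite subst2X !polyC0 addr0.
- by rewrite subst2Y !polyC0 addr0.
Qed.

Definition smooth_origin f := f.[0, 0] = 0 /\ (f`_1`_0 != 0 \/ f`_0`_1 != 0).

Lemma has_mult1E f : has_mult 1 f <-> smooth_origin f.
Proof.
rewrite /smooth_origin horner00; split=> [[low [i [j [ij fij]]]]|[f0 f1]].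
  split; first exact: low.
  have : (i = 1 /\ j = 0 \/ i = 0 /\ j = 1)%N by lia.
  by case=> -[ei ej]; rewrite ei ej in fij; [left|right].
split=> [i j|]; first by rewrite ltnS leqn0 addn_eq0 => /andP[/eqP-> /eqP->].
by case: f1 => f1; [exists 1%N, 0%N|exists 0%N, 1%N].
Qed.

Lemma linear_coefs c A B : let f := c%:P%:P + A * 'X + B * 'Y in
  f`_1`_0 = A.[0, 0] /\ f`_0`_1 = B.[0, 0].
Proof.
by split; rewrite !coefD coefC coefMX coefMC /= ?coefMX ?coefC
  ?coef0 /= horner00 ?add0r ?addr0.
Qed.

Lemma linear_expansion f : exists A B,
  f = (f.[0, 0])%:P%:P + A * 'X + B * 'Y.
Proof.
have [A fE] := poly_factor f 0.
have /root0_factor[b bE] : (f.[0] - (f.[0, 0])%:P).[0] = 0.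
  by rewrite hornerD hornerN hornerC polyC0 subrr.
exists A, b%:P; rewrite {1}fE polyC0 subr0 -[f.[0] in LHS](subrK (f.[0, 0])%:P) bE.
by rewrite polyCD polyCM; ring.
Qed.

Lemma smooth_origin_swap f : smooth_origin (swapXY f) <-> smooth_origin f.
Proof.
rewrite /smooth_origin horner2_swapXY !coef_swapXY.
by split=> -[f0 [f1|f1]]; split=> //; [right|left|right|left].
Qed.

Lemma smooth_origin_shear f :
  smooth_origin (subst2 'X ('X + 'Y) f) <-> smooth_origin f.
Proof.
have [A [B fE]] := linear_expansion f; set S := subst2 _ _.
have S00 h : (S h).[0, 0] = h.[0, 0] by have [_ _] := local_chart_shear.
have SE : S f = (f.[0, 0])%:P%:P + (S A + S B) * 'X + S B * 'Y.
  by rewrite fE /S !rmorphD !rmorphM /= subst2C subst2X subst2Y -fE; ring.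
have [f10 f01] := linear_coefs f.[0, 0] A B; rewrite -fE in f10 f01.
have [s10 s01] := linear_coefs f.[0, 0] (S A + S B) (S B); rewrite -SE in s10 s01.
rewrite /smooth_origin S00 f10 f01 s10 s01 horner00D !S00.
split=> -[f0 f1]; split=> //.
  have [B0|B0] := eqVneq B.[0, 0] 0; last by right.
  by left; move: f1; rewrite B0 addr0 eqxx => -[].
have [B0|B0] := eqVneq B.[0, 0] 0; last by right.
by left; move: f1; rewrite B0 addr0 eqxx => -[].
Qed.

Lemma quadratic_coefs A B D : let f := A * 'X^2 + B * 'Y * 'X + D * ('X^2)%:P in
  [/\ forall i j, (i + j < 2)%N -> f`_i`_j = 0, f`_2`_0 = A.[0, 0],
      f`_1`_1 = B.[0, 0] & f`_0`_2 = D.[0, 0]].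
Proof.
move=> f; rewrite !horner00.
have fE i j : f`_i`_j = (if (i < 2)%N then 0 else A`_(i - 2)`_j)
    + (if i == 0%N then 0 else if j == 0%N then 0 else B`_i.-1`_j.-1)
    + (if (j < 2)%N then 0 else D`_i`_(j - 2)).
  rewrite !coefD coefMXn coefMX coefMC coefMC coefMXn !(fun_if (fun p : {poly K} => p`_j)).
  by rewrite coefMX !coef0.
split=> [i j|||]; rewrite ?fE ?add0r ?addr0 //.
by case: i => [|[|i]]; case: j => [|[|j]]; rewrite ?addnS ?addSn //= ?addr0.
Qed.

End Charts.

(** Up to exchanging the coordinates, the tangent cone contains y^2, except for a
    node with tangent cone xy, which a shear turns into x (x + y). *)
Theorem A_form_chart (K : numClosedFieldType) (C : {poly {poly K}}) (P : K * K)
    (m : nat) (s : bool) :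
    has_mult 2 (centered C P) -> resolved m (if s then 2 else 1) (centered C P) ->
  exists F : {rmorphism {poly {poly K}} -> {poly {poly K}}},
  [/\ local_chart P F, forall D, smooth_at D P <-> smooth_origin (F D) &
      exists p a b g, A_form s m (F C) p a b g].
Proof.
move=> C2 resC; have [node nfy nfx] := resolved_A_form resC (erefl _) C2.
have chartP := local_chart_centered P.
have smoothP D : smooth_at D P <-> smooth_origin (centered D P) by exact: has_mult1E.
have [C20|C20] := eqVneq (centered C P)`_2`_0 0; last first.
  by exists (subst2 ('X + P.1%:P%:P) ('Y + P.2%:P%:P)); split=> //; exact: nfx.
have [C02|C02] := eqVneq (centered C P)`_0`_2 0; last first.
  exists (swapXY \o subst2 ('X + P.1%:P%:P) ('Y + P.2%:P%:P)); split.
  - exact: (local_chart_comp chartP (local_chart_swap K)).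
  - by move=> D; rewrite smoothP -smooth_origin_swap.
  - exact: nfy.
have C11 : (centered C P)`_1`_1 != 0.
  have [_ [i [j [ij Cij]]]] := C2.
  have : (i = 0 /\ j = 2 \/ (i = 1 /\ j = 1) \/ (i = 2 /\ j = 0))%N by lia.
  by case=> [|[]] -[ei ej]; move: Cij; rewrite ei ej ?C02 ?C20 ?eqxx.
have [m1 sT] : m = 1%N /\ s.
  by apply: node; rewrite /tangent_disc C20 mulr0 mul0r subr0 expf_neq0.
exists (subst2 'X ('X + 'Y) \o subst2 ('X + P.1%:P%:P) ('Y + P.2%:P%:P)); split.
- exact: (local_chart_comp chartP (local_chart_shear K)).
- by move=> D; rewrite smoothP -smooth_origin_shear.
have [low _] := C2.
have [a [b [g [CE a0 b0 g0]]]] := double_expansion low.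
set S := subst2 'X _.
have S00 h : (S h).[0, 0] = h.[0, 0] by have [_ _] := local_chart_shear K.
have SE : S (centered C P) = (S a%:P + S b%:P + S g) * 'X^2
    + (S a%:P *+ 2 + S b%:P) * 'Y * 'X + S a%:P * ('X^2)%:P.
  rewrite CE !(polyCM, polyC_exp) expr2 /S !rmorphD !rmorphM /= subst2X subst2Y.
  move: (subst2 _ _ a%:P) (subst2 _ _ b%:P) (subst2 _ _ g) => A B D.
  by ring.
have Sa : (S a%:P).[0, 0] = 0 by rewrite S00 hornerC a0 C02.
have Sb : (S b%:P).[0, 0] = (centered C P)`_1`_1 by rewrite S00 hornerC b0.
have Sg : (S g).[0, 0] = 0 by rewrite S00 g0 C20.
rewrite m1 sT /= -/S SE.
move: (S a%:P) (S b%:P) (S g) Sa Sb Sg => A B D A0 B0 D0.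
have [low' s20 s11 s02] := quadratic_coefs (A + B + D) (A *+ 2 + B) A.
apply: node_A_form => //.
  rewrite /tangent_disc s11 s20 s02 A0 mulr0 subr0 mulr2n !horner00D A0 B0 !add0r.
  exact: expf_neq0.
by rewrite s20 !horner00D A0 B0 D0 add0r addr0.
Qed.

(** * Contact of smooth curves with a double point *)

Section Contact.
Variable K : fieldType.
Implicit Types (f g h c : {poly {poly K}}) (p a b d e w : {poly K}) (n k r : nat).
Variables (s : bool) (r : nat) (f g : {poly {poly K}}) (p a b : {poly K}).
Hypotheses (nf : A_form s r f p a b g) (r_gt0 : (0 < r)%N).

Lemma vertical_codim c : c.[0, 0] = 0 -> c`_1`_0 = 0 -> c`_0`_1 != 0 ->
  codim_ge f c 2 /\ ~ codim_ge f c 3.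
Proof.
move=> c0 c10 c01.
have c'0 : c^`().[0, 0] = 0 by rewrite deriv_coef00.
have [q [q0 q2 cq]] := vertical_graph 3 c0 c'0 c01.
have [w w0 fq] := vertical_contact nf r_gt0 q2.
have sc'0 : (swapXY c)^`().[0, 0] != 0 by rewrite deriv_coef00 coef_swapXY.
split.
  apply: codim_ge_swap; apply: (codim_ge_graph q0).
    by rewrite -[_.[q]]/(eval_inner q f) fq dvdp_mulr.
  by apply: dvdp_trans cq; rewrite dvdp_exp2l.
rewrite -[f]swapXYK -[c]swapXYK => /codim_ge_swap.
exact: (codim_lt_graph sc'0 q0 cq fq w0).
Qed.

Lemma graph_codim c d : c.[0, 0] = 0 -> c`_1`_0 != 0 ->
    d.[0] = 0 -> 'X^(2 * r + 2) %| c.[d] ->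
  (exists2 k, (k <= r)%N & codim_ge f c (2 * k) /\ ~ codim_ge f c (2 * k).+1) \/
  (exists e, [/\ d = p + 'X^r * e,
     a.[0] + b.[0] * e.[0] + g.[0, 0] * e.[0] ^+ 2 = 0 & codim_ge f c (2 * r + 1)]).
Proof.
move=> c0 c10 d0 cd.
have c'0 : c^`().[0, 0] != 0 by rewrite deriv_coef00.
have cd' m : (m <= 2 * r + 2)%N -> 'X^m %| c.[d].
  by move=> le_m; apply: dvdp_trans cd; rewrite dvdp_exp2l.
have [[k [w [le_kr fd w0]]]|[e [dE e0 fd]]] := contact_dichotomy nf d0.
  left; exists k => //; split.
    by apply: (codim_ge_graph d0); [rewrite fd dvdp_mulr|rewrite cd' //; lia].
  by apply: (codim_lt_graph c'0 d0 _ fd w0); rewrite cd' //; lia.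
right; exists e; split=> //; apply: (codim_ge_graph d0) => //.
by rewrite cd' //; lia.
Qed.

(** A vertical curve falls under the first alternative, with k = 1. *)
Lemma smooth_codim c : smooth_origin c ->
  (exists2 k, (k <= r)%N & codim_ge f c (2 * k) /\ ~ codim_ge f c (2 * k).+1) \/
  [/\ c`_1`_0 != 0, c.[0, 0] = 0 & exists e, let d := picard c (2 * r + 1) in
   [/\ d = p + 'X^r * e,
     a.[0] + b.[0] * e.[0] + g.[0, 0] * e.[0] ^+ 2 = 0 & codim_ge f c (2 * r + 1)]].
Proof.
move=> [c0 c1]; have [c10|c10] := eqVneq c`_1`_0 0.
  left; exists 1%N => //; apply: vertical_codim => //.
  by case: c1 => //; rewrite c10 eqxx.
have c'0 : c^`().[0, 0] != 0 by rewrite deriv_coef00.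
have [d0 cd] := picard_graph (2 * r + 1) c0 c'0.
rewrite -addn1 -addnA in cd.
by have [] := graph_codim c0 c10 d0 cd; [left|right].
Qed.

Lemma graph_curve_coefs d : d.[0] = 0 -> smooth_origin ('X - d%:P) /\
  (('X - d%:P)^`().[0, 0] != 0).
Proof.
move=> d0; have c1 : ('X - d%:P)`_1`_0 = 1.
  by rewrite coefB coefX coefC subr0 -horner0E -polyC1 hornerC.
rewrite deriv_coef00 /smooth_origin c1 oner_eq0; split=> //; split; last by left.
by rewrite !(hornerD, hornerN, hornerX, hornerC) d0 subrr.
Qed.

Lemma branch_codim t : a.[0] + b.[0] * t + g.[0, 0] * t ^+ 2 = 0 ->
  codim_ge f ('X - (p + 'X^r * t%:P)%:P) (2 * r + 1).
Proof.
move=> root_t; set d := p + _; have [p0 _ _ _] := nf.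
have d0 : d.[0] = 0.
  by rewrite hornerD hornerM hornerXn p0 expr0n eqn0Ngt r_gt0 mul0r addr0.
have dE : d - p = 'X^r * t%:P by rewrite addrC addKr.
have /root0_factor[w wE] : (a + b * t%:P + g.[d] * t%:P ^+ 2).[0] = 0.
  by rewrite !(hornerD, hornerM, horner_exp, hornerC) (horner_at0 _ d0).
apply: (codim_ge_graph d0).
  by rewrite (contact_at nf dE) wE mulrA -exprSr addn1 dvdp_mulr.
by rewrite hornerD hornerN hornerX hornerC subrr dvdp0.
Qed.

End Contact.

Lemma two_roots (K : numClosedFieldType) (a b c : K) : c != 0 ->
  b ^+ 2 != 4%:R * a * c -> exists t1 t2, [/\ t1 != t2,
    a + b * t1 + c * t1 ^+ 2 = 0 & a + b * t2 + c * t2 ^+ 2 = 0].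
Proof.
move=> c0 D0; pose D := sqrtC (b ^+ 2 - 4%:R * a * c).
have DD : D ^+ 2 = b ^+ 2 - 4%:R * a * c by rewrite sqrtCK.
have Dn0 : D != 0 by rewrite sqrtC_eq0 subr_eq0.
have two0 : (2 : K) != 0 by rewrite pnatr_eq0.
have root t e : e ^+ 2 = D ^+ 2 -> t = (- b + e) / (2 * c) -> a + b * t + c * t ^+ 2 = 0.
  move=> eD ->; rewrite (_ : _ + _ = (4%:R * c)^-1 * (e ^+ 2 - (b ^+ 2 - 4%:R * a * c))).
    by rewrite eD DD subrr mulr0.
  by field; rewrite ?c0 ?two0 ?pnatr_eq0.
exists ((- b + D) / (2 * c)), ((- b - D) / (2 * c)); split.
- rewrite -subr_eq0 -mulrBl mulf_eq0 invr_eq0 mulf_eq0 (negPf two0) (negPf c0) orbF.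
  rewrite (_ : - b + D - _ = 2 * D); last by ring.
  by rewrite mulf_eq0 (negPf two0) (negPf Dn0).
- exact: (root _ D).
- by apply: (root _ (- D)); rewrite // sqrrN.
Qed.

Section ChartContact.
Variable R : realType.
Let K : numClosedFieldType := R[i].
Variables (P : K * K) (F : {rmorphism {poly {poly K}} -> {poly {poly K}}}).
Hypothesis chartF : local_chart P F.
Hypothesis smoothF : forall D, smooth_at D P <-> smooth_origin (F D).
Variables (s : bool) (r : nat) (C g : {poly {poly K}}) (p a b : {poly K}).
Hypotheses (nf : A_form s r (F C) p a b g) (r_gt0 : (0 < r)%N).
Implicit Types (D : {poly {poly K}}).

(** An equation vanishing at P is not a unit, and one with a nonzero linear part is
    not zero. *)
Lemma smooth_plane_curve D : smooth_at D P -> plane_curve D.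
Proof.
move=> /smoothF[FD0 FD1]; have [bijF _ evF] := chartF; split.
  by apply: contraTneq isT => D0; move: FD1; rewrite D0 rmorph0 !coef0 eqxx => -[].
apply/negP => /divrr /(congr1 (fun f => f.[P.1, P.2])).
by rewrite !hornerM -evF FD0 mul0r -polyC1 !hornerC => /esym/eqP; rewrite oner_eq0.
Qed.

Lemma chart_graph_curve d : d.[0] = 0 -> exists D, [/\ plane_curve D,
  smooth_at D P & F D = 'X - d%:P].
Proof.
move=> d0; have [[G FK GK] _ _] := chartF.
have smD : smooth_at (G ('X - d%:P)) P.
  by apply/smoothF; rewrite GK; have [] := graph_curve_coefs d0.
by exists (G ('X - d%:P)); rewrite GK; split=> //; exact: smooth_plane_curve.
Qed.

Lemma even_contact D : smooth_at D P -> (imult C D P <= ((2 * r)%N%:R)%:E)%E ->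
  exists k : nat, imult C D P = ((2 * k)%N%:R)%:E.
Proof.
move=> /smoothF smD le_2r.
have [[k _ codimk]|[_ _ [e [_ _ ge]]]] := smooth_codim nf r_gt0 smD.
  by exists k; apply/(imult_eq chartF).
have /(imult_ge chartF) ge' := ge.
by have := le_trans ge' le_2r; rewrite lee_fin ler_nat addn1 ltnn.
Qed.

Lemma branches_contact : s -> exists D1 D2 : {poly {poly R[i]}},
      [/\ plane_curve D1 /\ smooth_at D1 P,
          plane_curve D2 /\ smooth_at D2 P,
          (((2 * r + 1)%N%:R)%:E <= imult C D1 P)%E,
          (((2 * r + 1)%N%:R)%:E <= imult C D2 P)%E &
          imult D1 D2 P = (r%:R)%:E].
Proof.
move=> sT; have [p0 g0 fE dE] := nf; rewrite sT in dE.
have [t1 [t2 [t12 root1 root2]]] := two_roots g0 dE.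
have d0 t : (p + 'X^r * t%:P).[0] = 0.
  by rewrite hornerD hornerM hornerXn p0 expr0n eqn0Ngt r_gt0 mul0r addr0.
have [D1 [cD1 sD1 D1E]] := chart_graph_curve (d0 t1).
have [D2 [cD2 sD2 D2E]] := chart_graph_curve (d0 t2).
exists D1, D2; split.
- by split; [exact: cD1|exact: sD1].
- by split; [exact: cD2|exact: sD2].
- by apply/(imult_ge chartF); rewrite D1E; apply: (branch_codim nf r_gt0 root1).
- by apply/(imult_ge chartF); rewrite D2E; apply: (branch_codim nf r_gt0 root2).
apply/(imult_eq chartF); rewrite D1E D2E.
have [_ c'0] := graph_curve_coefs (d0 t2).
have on_graph n : 'X^n %| ('X - (p + 'X^r * t2%:P)%:P).[p + 'X^r * t2%:P].
  by rewrite hornerD hornerN hornerX hornerC subrr dvdp0.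
have diff : ('X - (p + 'X^r * t1%:P)%:P).[p + 'X^r * t2%:P] = 'X^r * (t2 - t1)%:P.
  by rewrite hornerD hornerN hornerX hornerC polyCB; ring.
split; first by apply: (codim_ge_graph (d0 t2)) => //; rewrite diff dvdp_mulr.
apply: (codim_lt_graph c'0 (d0 t2) (on_graph _) diff).
by rewrite hornerC subr_eq0 eq_sym.
Qed.

(** Contact 2r + 1 with a cusp forces the graph of D to agree with p up to order r,
    and is then exact. *)
Lemma cusp_codim_max D : ~~ s -> smooth_origin (F D) ->
    codim_ge (F C) (F D) (2 * r + 1) ->
  [/\ ~ codim_ge (F C) (F D) (2 * r + 2), (F D)^`().[0, 0] != 0 &
      exists d, [/\ d.[0] = 0, 'X^(2 * r + 2) %| (F D).[d] & 'X^(r.+1) %| d - p]].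
Proof.
move=> /negPf sF smD ge; have nf' := nf; rewrite sF in nf'.
have [[k le_kr [_ lt]]|[c10 c0 [e [dE root_e _]]]] := smooth_codim nf r_gt0 smD.
  by case: lt; apply: codim_ge_le ge; lia.
have c'0 : (F D)^`().[0, 0] != 0 by rewrite deriv_coef00.
have [d0 cd] := picard_graph (2 * r + 1) c0 c'0; rewrite -addn1 -addnA in cd.
have [e0 [w w0 fd]] := cusp_contact_max nf' root_e; rewrite -dE in fd.
split=> //.
  rewrite (_ : (2 * r + 2 = (2 * r + 1).+1)%N); last by lia.
  apply: (codim_lt_graph c'0 d0 _ fd w0).
  by rewrite (_ : ((2 * r + 1).+1 = 2 * r + 2)%N) //; lia.
exists (picard (F D) (2 * r + 1)); split=> //.
have [e' eE] := root0_factor e0; rewrite eE in dE.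
by rewrite dE addrC addKr mulrA -exprSr dvdp_mulr.
Qed.

(** The last claim follows from [cusp_odd_smooth], which makes both curves smooth:
    their graphs agree with p, hence with each other, up to order r. *)
Lemma cusp_contact : ~~ s ->
  [/\ (forall D, smooth_at D P -> (imult C D P <= ((2 * r + 1)%N%:R)%:E)%E),
      (exists D : {poly {poly R[i]}}, [/\ plane_curve D, smooth_at D P &
               imult C D P = ((2 * r + 1)%N%:R)%:E]) &
      (forall D1 D2 : {poly {poly R[i]}},
           imult C D1 P = ((2 * r + 1)%N%:R)%:E ->
           imult C D2 P = ((2 * r + 1)%N%:R)%:E ->
           ((r%:R)%:E < imult D1 D2 P)%E)].
Proof.
move=> sF; have [p0 g0 _ dE] := nf; rewrite (negPf sF) in dE.
have [a0 b0 _] := dE.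
have step : (2 * r + 2 = (2 * r + 1).+1)%N by lia.
have le D : smooth_at D P -> (imult C D P <= ((2 * r + 1)%N%:R)%:E)%E.
  move=> /smoothF smD; have [ge|lt] := pselect (codim_ge (F C) (F D) (2 * r + 1)).
    have [lt' _ _] := cusp_codim_max sF smD ge.
    by have /(imult_eq chartF) -> // : codim_ge (F C) (F D) (2 * r + 1) /\
      ~ codim_ge (F C) (F D) (2 * r + 1).+1 by rewrite -step.
  rewrite leNgt; apply/negP => /ltW /(imult_ge chartF); exact: lt.
split; first exact: le.
  have root0 : a.[0] + b.[0] * 0 + g.[0, 0] * 0 ^+ 2 = 0.
    by rewrite a0 mulr0 expr0n mulr0 !addr0.
  have d0 : (p + 'X^r * 0%:P).[0] = 0 by rewrite polyC0 mulr0 addr0.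
  have [D [cD sD DE]] := chart_graph_curve d0.
  have geD : codim_ge (F C) (F D) (2 * r + 1).
    by rewrite DE; apply: (branch_codim nf r_gt0 root0).
  exists D; split; [exact: cD|exact: sD|].
  apply/(imult_eq chartF); split; first exact: geD.
  have [|lt' _ _] := cusp_codim_max sF _ geD; first exact/smoothF.
  by rewrite -step.
move=> D1 D2 /(imult_eq chartF)[ge1 lt1] /(imult_eq chartF)[ge2 lt2].
have nf' := nf; rewrite (negPf sF) in nf'.
have sm D : codim_ge (F C) (F D) (2 * r + 1) -> ~ codim_ge (F C) (F D) (2 * r + 1).+1 ->
    smooth_origin (F D).
  rewrite addn1 => ge lt; have [D0 D'0] := cusp_odd_smooth nf' r_gt0 ge lt.
  by split=> //; left; rewrite -deriv_coef00.
have [_ D1'0 [d1 [d10 D1d1 d1p]]] := cusp_codim_max sF (sm _ ge1 lt1) ge1.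
have [_ D2'0 [d2 [d20 D2d2 d2p]]] := cusp_codim_max sF (sm _ ge2 lt2) ge2.
apply: (@lt_le_trans _ _ (r.+1%:R)%:E); first by rewrite lte_fin ltr_nat.
apply/(imult_ge chartF); apply: (codim_ge_graph d20); last first.
  by apply: dvdp_trans D2d2; rewrite dvdp_exp2l //; lia.
have [e De] := horner_sub_dvd (F D1) d1 d2.
rewrite -[X in _ %| X](subrK (F D1).[d1]) De dvdp_add //; last first.
  by apply: dvdp_trans D1d1; rewrite dvdp_exp2l //; lia.
rewrite dvdp_mulr // (_ : d2 - d1 = (d2 - p) - (d1 - p)); last by ring.
by rewrite dvdp_sub.
Qed.

End ChartContact.

(** * Equations of the curves with high contact *)

Lemma graph_analytic_equation (K : numFieldType) (d : {poly K}) :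
  local_analytic_equation (swapXY ('X - d%:P)) (fun i => d`_i).
Proof.
exists 1; split=> // x _; have [|cvgd limd] := @pseries_lim K (fun i => d`_i) x d.[x].
  move=> eps eps_gt0; exists (size d) => n le_dn.
  by rewrite (horner_coef_wide _ le_dn) subrr normr0.
split; first exact: cvgd.
move=> y _; rewrite limd horner2_swapXY !(hornerD, hornerN, hornerX, hornerC).
by split=> [/eqP|->]; rewrite ?subrr // subr_eq0 => /eqP.
Qed.

Lemma vertical_tangent (K : fieldType) (C : {poly {poly K}}) : has_mult 2 C ->
  ~ tangent_direction C 0 1 -> C`_0`_2 != 0.
Proof.
move=> C2; apply: contra_notN => /eqP C02; split.
  by rewrite xpair_eqE oner_eq0 andbF.
exists 2%N; split=> //; rewrite !big_ord_recr big_ord0 /= C02.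
by rewrite !mul0r !expr0n /= !mulr0 !mul0r !addr0.
Qed.

(** The coefficient of x^2 in f(x, p(x)) is the leading form of f at (1, p'(0)). *)
Lemma graph_tangent (K : fieldType) (C : {poly {poly K}}) (p : {poly K}) :
    has_mult 2 C -> p.[0] = 0 -> (swapXY C).[p]`_2 = 0 ->
  tangent_direction C 1 p`_1.
Proof.
move=> C2 p0 Cp; split; first by rewrite xpair_eqE oner_eq0.
exists 2%N; split=> //.
have low i j : (i + j < 2)%N -> (swapXY C)`_i`_j = 0.
  by have [low _] := C2 => ij; rewrite coef_swapXY low // addnC.
have [a [b [g [CE]]]] := double_expansion low; rewrite !coef_swapXY => a0 b0 g0.
have [p1 pE] := root0_factor p0.
have p1E : p`_1 = p1.[0] by rewrite pE coefXM horner0E.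
have key (h : {poly K}) :
    'X^2 * a + 'X * b * p + h * p ^+ 2 = 'X^2 * (a + b * p1 + h * p1 ^+ 2).
  by rewrite pE; ring.
move: Cp; rewrite CE !(hornerD, hornerM, hornerC, hornerX, horner_exp).
rewrite key coef_XnM_lead !(hornerD, hornerM, horner_exp) (horner_at0 _ p0) a0 b0 g0 -p1E.
move=> E; rewrite !big_ord_recr big_ord0 /= !expr1n -[RHS]E.
by ring.
Qed.

Lemma quadratic_roots (K : fieldType) (a b c t1 t2 t : K) : c != 0 -> t1 != t2 ->
    a + b * t1 + c * t1 ^+ 2 = 0 -> a + b * t2 + c * t2 ^+ 2 = 0 ->
    a + b * t + c * t ^+ 2 = 0 ->
  t = t1 \/ t = t2.
Proof.
move=> c0 t12 root1 root2 root.
have slope u v : u != v -> a + b * u + c * u ^+ 2 = 0 -> a + b * v + c * v ^+ 2 = 0 ->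
    b + c * (u + v) = 0.
  rewrite -subr_eq0 => uv root_u root_v; apply: (mulfI uv); rewrite mulr0.
  by rewrite -[RHS](subrr 0) -[X in _ = X - _]root_u -[X in _ = _ - X]root_v; ring.
have [->|tt1] := eqVneq t t1; [by left|right].
apply: (mulfI c0); apply: (addIr (c * t1)); apply: (addrI b).
rewrite -!mulrDr slope // (addrC t2) slope //.
Qed.

Section SeriesAtOrigin.
Variable R : realType.
Let K : numClosedFieldType := R[i].
Variables (s : bool) (r : nat) (C g : {poly {poly R[i]}}) (p a b : {poly R[i]}).
Hypotheses (nf : A_form s r (swapXY C) p a b g) (r_gt0 : (0 < r)%N).
Implicit Types (D : {poly {poly R[i]}}).

(** The coefficients of the convergent series are those of the polynomial graph that
    computes the contact, up to the order of that graph. *)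
Lemma high_contact_equation D : smooth_at D (0, 0) ->
    (((2 * r + 1)%N%:R)%:E <= imult C D (0, 0)%R)%E ->
  exists d : nat -> R[i], [/\ local_analytic_equation D d, d 0%N = 0,
    forall i, (i < r)%N -> d i = p`_i &
    exists t, d r = p`_r + t /\ a.[0] + b.[0] * t + g.[0, 0] * t ^+ 2 = 0].
Proof.
rewrite /smooth_at centered0 => /has_mult1E/smooth_origin_swap smD.
move=> /(imult_ge (local_chart_swap _)) /= ge.
have [[k le_kr [_ lt]]|[c10 c0 [e [dE root_e _]]]] := smooth_codim nf r_gt0 smD.
  by case: lt; apply: codim_ge_le ge; lia.
have c'0 : (swapXY D)^`().[0, 0] != 0 by rewrite deriv_coef00.
exists (fun i => (picard (swapXY D) i)`_i); split.
- by have := analytic_graph c0 c'0; rewrite swapXYK.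
- by rewrite /= coef0.
- move=> i lt_ir; rewrite -(@picard_coef_stable _ _ i (2 * r + 1)) //; last by lia.
  by rewrite dE coefD coef_XnM_low ?addr0.
- exists e.[0]; split=> //.
  rewrite -(@picard_coef_stable _ _ r (2 * r + 1)) //; last by lia.
  by rewrite dE coefD coef_XnM_lead.
Qed.

Lemma branch_equation t : a.[0] + b.[0] * t + g.[0, 0] * t ^+ 2 = 0 ->
  exists (D : {poly {poly R[i]}}) (d : nat -> R[i]),
    [/\ plane_curve D /\ smooth_at D (0, 0),
       (((2 * r + 1)%N%:R)%:E <= imult C D (0, 0)%R)%E,
       local_analytic_equation D d & d r = p`_r + t].
Proof.
move=> root_t; have [p0 _ _ _] := nf.
pose d := p + 'X^r * t%:P.
have d0 : d.[0] = 0.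
  by rewrite hornerD hornerM hornerXn p0 expr0n eqn0Ngt r_gt0 mul0r addr0.
have smooth_swap D : smooth_at D (0, 0) <-> smooth_origin (swapXY D).
  by rewrite /smooth_at centered0 has_mult1E smooth_origin_swap.
have [D [cD sD DE]] := chart_graph_curve (local_chart_swap _) smooth_swap d0.
exists D, (fun i => d`_i); split.
- by split; [exact: cD|exact: sD].
- apply/(imult_ge (local_chart_swap _)); rewrite DE.
  exact: (branch_codim nf r_gt0 root_t).
- by rewrite -[D]swapXYK [swapXY D]DE; exact: graph_analytic_equation.
- by rewrite /d coefD coef_XnM_lead hornerC.
Qed.

Lemma branch_tangent : double_point C (0, 0) -> ~~ s \/ (1 < r)%N ->
  tangent_direction C 1 p`_1.
Proof.
rewrite /double_point centered0 => C2 sr; have [p0 _ fE dE] := nf.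
apply: graph_tangent => //; rewrite fE.
have -> u v (h : {poly {poly R[i]}}) : (u%:P + v%:P * ('X - p%:P) + h * ('X - p%:P) ^+ 2).[p] = u.
  by rewrite !(hornerD, hornerM, hornerC, hornerX, horner_exp, hornerN); ring.
case: r r_gt0 sr => // -[|r'] _ sr; last by rewrite mulnS coef_XnM_low //; lia.
rewrite muln1 coef_XnM_lead.
by case: sr => // /negPf sF; rewrite sF in dE; case: dE.
Qed.

End SeriesAtOrigin.

Lemma A_singularity_odd (K : fieldType) (C : {poly {poly K}}) (P : K * K) r s :
  (0 < r)%N -> s = (2 * r - 1)%N -> A_singularity s C P -> resolved r 2 (centered C P).
Proof.
move=> r_gt0 -> [_ [m [e [m_gt0 + res]]]]; case: e res => res sE; last by lia.
by have -> : r = m by lia.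
Qed.

Lemma A_singularity_even (K : fieldType) (C : {poly {poly K}}) (P : K * K) r s :
  s = (2 * r)%N -> A_singularity s C P -> resolved r 1 (centered C P).
Proof.
move=> -> [_ [m [e [m_gt0 + res]]]]; case: e res => res sE; first by lia.
by have -> : r = m by lia.
Qed.


Theorem proposition2p2 (R : realType) (C : {poly {poly R[i]}})
    (P : R[i] * R[i]) (r : nat) :
  plane_curve C -> reduced_curve C -> double_point C P -> (0 < r)%N ->
  [/\
  (* (i) *)
   (A_singularity (2 * r - 1)%N C P \/ A_singularity (2 * r)%N C P ->
    forall D : {poly {poly R[i]}}, plane_curve D -> smooth_at D P ->
      (imult C D P <= ((2 * r)%N%:R)%:E)%E ->
      exists k : nat, imult C D P = ((2 * k)%N%:R)%:E),
  (* (ii) *)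
   (A_singularity (2 * r - 1)%N C P ->
    exists D1 D2 : {poly {poly R[i]}},
      [/\ plane_curve D1 /\ smooth_at D1 P,
          plane_curve D2 /\ smooth_at D2 P,
          (((2 * r + 1)%N%:R)%:E <= imult C D1 P)%E,
          (((2 * r + 1)%N%:R)%:E <= imult C D2 P)%E &
          imult D1 D2 P = (r%:R)%:E]),
  (* (iii) *)
   (A_singularity (2 * r)%N C P ->
    [/\ (forall D : {poly {poly R[i]}}, plane_curve D -> smooth_at D P ->
           (imult C D P <= ((2 * r + 1)%N%:R)%:E)%E),
        (exists D : {poly {poly R[i]}},
           [/\ plane_curve D, smooth_at D P &
               imult C D P = ((2 * r + 1)%N%:R)%:E]) &
        (forall D1 D2 : {poly {poly R[i]}}, plane_curve D1 -> plane_curve D2 ->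
           imult C D1 P = ((2 * r + 1)%N%:R)%:E ->
           imult C D2 P = ((2 * r + 1)%N%:R)%:E ->
           ((r%:R)%:E < imult D1 D2 P)%E)]) &
  (* (iv) *)
   (forall s : nat, P = (0, 0) -> A_singularity s C P ->
    (s = 2 * r - 1 \/ s = 2 * r)%N -> (2 <= s)%N ->
    ~ tangent_direction C 0 1 ->
    exists c : nat -> R[i], tangent_direction C 1 (c 1%N) /\
    [/\ (s = (2 * r)%N ->
         forall D : {poly {poly R[i]}}, plane_curve D -> smooth_at D P ->
           (((2 * r + 1)%N%:R)%:E <= imult C D P)%E ->
           exists d : nat -> R[i],
             [/\ local_analytic_equation D d, d 0%N = 0 &
                 forall i : nat, (1 <= i <= r)%N -> d i = c i]) &
        (s = (2 * r - 1)%N ->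
         exists a b : R[i],
         [/\ a != b,
             (forall D : {poly {poly R[i]}}, plane_curve D -> smooth_at D P ->
               (((2 * r + 1)%N%:R)%:E <= imult C D P)%E ->
               exists d : nat -> R[i],
                 [/\ local_analytic_equation D d, d 0%N = 0,
                     (forall i : nat, (1 <= i < r)%N -> d i = c i) &
                     d r = a \/ d r = b]) &
             (forall a' : R[i], a' = a \/ a' = b ->
               exists (D : {poly {poly R[i]}}) (d : nat -> R[i]),
                 [/\ plane_curve D /\ smooth_at D P,
                     (((2 * r + 1)%N%:R)%:E <= imult C D P)%E,
                     local_analytic_equation D d & d r = a'])])])].
Proof.
move=> _ _ C2 r_gt0.
have form2 : resolved r 2 (centered C P) -> _ := @A_form_chart R[i] C P r true C2.
have form1 : resolved r 1 (centered C P) -> _ := @A_form_chart R[i] C P r false C2.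
split.
- move=> sing D _ smD le_2r.
  case: sing => [/(A_singularity_odd r_gt0 erefl)/form2|/(A_singularity_even erefl)/form1].
    move=> [F [chartF smoothF [p [a [b [g nf]]]]]].
    exact: (even_contact chartF smoothF nf r_gt0 smD le_2r).
  move=> [F [chartF smoothF [p [a [b [g nf]]]]]].
  exact: (even_contact chartF smoothF nf r_gt0 smD le_2r).
- move=> /(A_singularity_odd r_gt0 erefl)/form2[F [chartF smoothF [p [a [b [g nf]]]]]].
  exact: (branches_contact chartF smoothF nf r_gt0 isT).
- move=> /(A_singularity_even erefl)/form1[F [chartF smoothF [p [a [b [g nf]]]]]].
  have [le ex gt] := cusp_contact chartF smoothF nf r_gt0 isT.
  split; [by move=> D _; exact: le|exact: ex|by move=> D1 D2 _ _; exact: gt].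
move=> s P0 sing sE s_ge2 no_vert; rewrite {}P0 in C2 sing form1 form2 *.
rewrite /double_point centered0 in C2; rewrite centered0 in form1 form2.
have C02 := vertical_tangent C2 no_vert.
case: sE => sE.
  have res : resolved r 2 C by rewrite -(centered0 C); exact: A_singularity_odd sing.
  have r_gt1 : (1 < r)%N by lia.
  have [_ /(_ C02)[p [a [b [g nf]]]] _] := resolved_A_form res (s := true) erefl C2.
  exists (fun i => p`_i); split.
    by apply: (branch_tangent nf r_gt0); [rewrite /double_point centered0|right].
  split; first by move=> s_even; exfalso; lia.
  move=> _; have [p0 g0 _ dE] := nf.
  have [t1 [t2 [t12 root1 root2]]] := two_roots g0 dE.
  exists (p`_r + t1), (p`_r + t2); split.
  - by rewrite (inj_eq (addrI _)).
  - move=> D _ smD ge; have [d [dD d0 d_low [t [dr root]]]] :=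
      high_contact_equation nf r_gt0 smD ge.
    exists d; split=> //; first by move=> i /andP[_]; exact: d_low.
    by rewrite dr; have [->|->] := quadratic_roots g0 t12 root1 root2 root; [left|right].
  - move=> a' [->|->]; first exact: (branch_equation nf r_gt0 root1).
    exact: (branch_equation nf r_gt0 root2).
have res : resolved r 1 C by rewrite -(centered0 C); exact: A_singularity_even sing.
have [_ /(_ C02)[p [a [b [g nf]]]] _] := resolved_A_form res (s := false) erefl C2.
exists (fun i => p`_i); split.
  by apply: (branch_tangent nf r_gt0); [rewrite /double_point centered0|left].
split; last by move=> s_odd; exfalso; lia.
move=> _ D _ smD ge.
have [d [dD d0 d_low [t [dr root]]]] := high_contact_equation nf r_gt0 smD ge.
have [p0 g0 _ [a0 b0 _]] := nf.
have t0 : t = 0.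
  move/eqP: root; rewrite a0 b0 mul0r !add0r mulf_eq0 (negPf g0) expf_eq0 /=.
  by move/eqP.
exists d; split=> // i /andP[_]; rewrite leq_eqVlt => /orP[/eqP->|/d_low //].
by rewrite dr t0 addr0.
Qed.
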